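(* Let $G$ be the Gram matrix of a complex equiangular $(9,3)$-frame. Then there is a complex number $a$ with $|a|=1$ such that $G$ is equivalent to \[G_9^{(1)}(a):=\tfrac12\left(3I_9-H_9^{(1)}(a)\right),\] where, with $\omega=-\frac12+\mathbf{i}\frac{\sqrt3}{2}$, \[H_9^{(1)}(a)=\left[ \begin{array}{ccc|ccc|ccc} 1 & 1 & 1 & 1 & 1 & 1 & 1 & 1 & 1 \\ 1 & 1 & 1 & \omega & \omega & \omega & \omega^2 & \omega^2 & \omega^2 \\ 1 & 1 & 1 & \omega^2 & \omega^2 & \omega^2 & \omega & \omega & \omega \\ \hline 1 & \omega^2 & \omega & 1 & \omega^2 & \omega & a & a \omega^2 & a \omega \\ 1 & \omega^2 & \omega & \omega & 1 & \omega^2 & a \omega^2 & a \omega & a \\ 1 & \omega^2 & \omega & \omega^2 & \omega & 1 & a \omega & a & a \omega^2 \\ \hline 1 & \omega & \omega^2 & \overline{a} & \overline{a}\omega & \overline{a}\omega^2 & 1 & \omega & \omega^2 \\ 1 & \omega & \omega^2 & \overline{a}\omega & \overline{a}\omega^2 & \overline{a} & \omega^2 & 1 & \omega \\ 1 & \omega & \omega^2 & \overline{a}\omega^2 & \overline{a} & \overline{a}\omega & \omega & \omega^2 & 1 \end{array} \right].\]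
   Context: For integers $n\ge m\ge 1$ (with $n\geq 2$), a complex equiangular tight frame, or complex equiangular $(n,m)$-frame, is a collection of $n$ unit vectors $\varphi_1,\dots,\varphi_n\in\mathbb{C}^m$ such that $|\langle\varphi_i,\varphi_j\rangle|=\alpha_{n,m}:=\sqrt{\frac{n-m}{m(n-1)}}$ for all $1\le i<j\le n$, and which is tight: the $m\times n$ matrix $F$ with columns $\varphi_1,\dots,\varphi_n$ has pairwise orthogonal rows of equal norm, i.e. $FF^\ast=\frac{n}{m}I_m$. Its Gram matrix is $G:=F^\ast F$; it is self-adjoint with unit diagonal, off-diagonal entries of modulus $\alpha_{n,m}$, and satisfies $mG^2=nG$. Two Gram matrices $G,G'$ of the same order are called equivalent if $G'=PDGD^\ast P^T$ for some permutation matrix $P$ and some unitary diagonal matrix $D$. *)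

(* Defs.v *)
From mathcomp Require Import all_boot all_order all_fingroup all_algebra.
From mathcomp Require Import sesquilinear spectral reals complex.

Set Implicit Arguments.
Unset Strict Implicit.
Unset Printing Implicit Defensive.

Import Order.TTheory GRing.Theory Num.Theory.

Local Open Scope ring_scope.
Local Open Scope sesquilinear_scope.

(* M ^t* is the conjugate transpose. *)

Section Frames.
Variable C : numClosedFieldType.

(* spectral.v defines dotmx on row vectors: dotmx u v = \sum_k u_k (v_k)^*. *)
Definition cdot m (u v : 'cV[C]_m) : C := dotmx u^T v^T.

Definition cnorm m (u : 'cV[C]_m) : C := sqrtC (cdot u u).

Definition frame_mx n m (phi : 'I_n -> 'cV[C]_m) : 'M[C]_(m, n) :=
  \matrix_(i, j) phi j i 0.

Definition etf_angle (n m : nat) : C :=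
  sqrtC ((n%:R - m%:R) / (m%:R * (n%:R - 1))).

Definition is_etf n m (phi : 'I_n -> 'cV[C]_m) : Prop :=
  [/\ (1 <= m <= n)%N /\ (2 <= n)%N,
      forall i, cnorm (phi i) = 1,
      forall i j : 'I_n, (i < j)%N -> `|cdot (phi i) (phi j)| = etf_angle n m
    & frame_mx phi *m (frame_mx phi) ^t* = (n%:R / m%:R)%:M].

Definition gram n m (phi : 'I_n -> 'cV[C]_m) : 'M[C]_n :=
  (frame_mx phi) ^t* *m frame_mx phi.

Definition gram_equiv n (G G' : 'M[C]_n) : Prop :=
  exists (s : 'S_n) (d : 'rV[C]_n),
    diag_mx d \is unitarymx /\
    G' = perm_mx s *m diag_mx d *m G *m (diag_mx d) ^t* *m (perm_mx s)^T.

End Frames.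

Section H9.
Variable R : realType.

Definition omega : R[i] := ((- (1 / 2)) +i* (Num.sqrt 3 / 2))%C.

Definition H9 (a : R[i]) : 'M[R[i]]_9 :=
  let w := omega in
  let w2 := omega ^+ 2 in
  let b := Num.conj a in
  \matrix_(i < 9, j < 9) nth 0 (nth [::]
    [:: [:: 1; 1;  1;   1;      1;      1;       1;      1;      1     ];
        [:: 1; 1;  1;   w;      w;      w;       w2;     w2;     w2    ];
        [:: 1; 1;  1;   w2;     w2;     w2;      w;      w;      w     ];

        [:: 1; w2; w;   1;      w2;     w;       a;      a * w2; a * w ];
        [:: 1; w2; w;   w;      1;      w2;      a * w2; a * w;  a     ];
        [:: 1; w2; w;   w2;     w;      1;       a * w;  a;      a * w2];

        [:: 1; w;  w2;  b;      b * w;  b * w2;  1;      w;      w2    ];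
        [:: 1; w;  w2;  b * w;  b * w2; b;       w2;     1;      w     ];
        [:: 1; w;  w2;  b * w2; b;      b * w;   w;      w2;     1     ]]
    i) j.

Definition G9 (a : R[i]) : 'M[R[i]]_9 := (1 / 2) *: (3 *: 1%:M - H9 a).

End H9.

(* Main.v *)
Require Import Defs.
From mathcomp Require Import all_boot all_order all_fingroup all_algebra.
From mathcomp Require Import sesquilinear spectral reals complex.
From mathcomp Require Import zify ring.

(** Put H = 3I - 2G: it is hermitian with unit diagonal and unimodular entries,
    and H^2 = 9I.  Since the nine projections span M_3(C), the frame is a
    2-design, so the entrywise square of H has the same properties, and hence so
    does the entrywise fourth power.  For i <> j the seven triple products
    t_k = H_ij H_jk H_ki (k <> i, j) therefore have first, second and fourth
    power sums equal to -2, which forces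
    \prod_k (X - t_k) = (X^2 + X + 1)^2 (X^3 - v) with |v| = 1.
    The cubes of the entries of H then have a very rigid pattern: after
    normalising the first row, either they are all 1 or they equal a constant
    v <> 1 exactly between two blocks of size 3 (v^-1 in the other order).  In
    both cases the nine vectors split into three linearly dependent triples
    (t = 1), and row sums together with the three linear relations determine H
    up to one phase a. *)

Set Implicit Arguments.
Unset Strict Implicit.
Unset Printing Implicit Defensive.

Import Order.TTheory GRing.Theory Num.Theory.

Local Open Scope ring_scope.
Local Open Scope sesquilinear_scope.

(** * Seven unimodular numbers with prescribed power sums *)

(** Computable on explicit lists, so that identities between these polynomials fall to [ring]. *)
Fixpoint elem_sym (R : comPzRingType) k (s : seq R) : R :=
  match k, s with
  | 0, _ => 1
  | k'.+1, [::] => 0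
  | k'.+1, x :: s' => elem_sym k s' + x * elem_sym k' s'
  end.

Lemma elem_sym_morph (R S : comPzRingType) (f : {rmorphism R -> S}) k s :
  f (elem_sym k s) = elem_sym k (map f s).
Proof.
elim: s k => [|x s IHs] [|k] /=; rewrite ?rmorph1 ?rmorph0 //.
by rewrite rmorphD rmorphM !IHs.
Qed.

Section Seven.
Variables (C : numClosedFieldType) (w : C).
Hypothesis w2 : w ^+ 2 + w + 1 = 0.

(** The roots, with multiplicity, of (X^2 + X + 1)^2 (X^3 - r^3). *)
Definition phase_list (r : C) : seq C :=
  [:: w; w; w ^+ 2; w ^+ 2; r; r * w; r * w ^+ 2].

Lemma prodXsubC7 (R : comNzRingType) (a b c d e f g : R) :
  let s := [:: a; b; c; d; e; f; g] in
  \prod_(x <- s) ('X - x%:P) =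
  'X^7 - (elem_sym 1 s)%:P * 'X^6 + (elem_sym 2 s)%:P * 'X^5
  - (elem_sym 3 s)%:P * 'X^4 + (elem_sym 4 s)%:P * 'X^3
  - (elem_sym 5 s)%:P * 'X^2 + (elem_sym 6 s)%:P * 'X - (elem_sym 7 s)%:P.
Proof.
move=> s; rewrite !big_cons big_nil !elem_sym_morph /s.
rewrite [map _ _]/=; set X := 'X.
move: a%:P b%:P c%:P d%:P e%:P f%:P g%:P X => a' b' c' d' e' f' g' X.
rewrite /=; ring.
Qed.

(** Conjugation inverts unimodular numbers, so it sends e_k to e_{7-k} / e_7. *)
Lemma elem_sym_recip7 (a b c d e f g : C) (s := [:: a; b; c; d; e; f; g]) :
  {in s, forall x, `|x| = 1} ->
  [/\ elem_sym 7 s * (elem_sym 1 s)^* = elem_sym 6 s,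
      elem_sym 7 s * (elem_sym 2 s)^* = elem_sym 5 s,
      elem_sym 7 s * (elem_sym 3 s)^* = elem_sym 4 s
    & elem_sym 7 s * (elem_sym 4 s)^* = elem_sym 3 s].
Proof.
move=> s1.
have sE : map Num.conj s = [:: a^-1; b^-1; c^-1; d^-1; e^-1; f^-1; g^-1].
  have cE x : x \in s -> x^* = x^-1.
    by move/s1 => x1; rewrite invC_norm x1 expr1n invr1 mul1r.
  by rewrite /= !cE // !inE eqxx ?orbT.
have s0 x : x \in s -> x != 0 by move/s1 => x1; rewrite -normr_eq0 x1 oner_eq0.
rewrite !elem_sym_morph sE.
by rewrite /s /=; split; field; rewrite !s0 // !inE eqxx ?orbT.
Qed.

(** Newton's identities give e_1 and e_2 and tie e_4 to e_3. The missing third power sum is replaced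
    by the symmetry between e_k and e_{7-k}, which leaves v = e_7 as the only free parameter; the
    coefficients then agree with those for [phase_list r], r^3 = v. *)
Lemma seven_phases (t : seq C) :
  size t = 7%N -> {in t, forall x, `|x| = 1} ->
  \sum_(x <- t) x = - 2 -> \sum_(x <- t) x ^+ 2 = - 2 ->
  \sum_(x <- t) x ^+ 4 = - 2 ->
  exists r, `|r| = 1 /\ perm_eq t (phase_list r).
Proof.
case: t => [|a [|b [|c [|d [|e [|f [|g [|? ?]]]]]]]] // _ t1.
rewrite !big_cons !big_nil => p1 p2 p4.
set s := [:: a; b; c; d; e; f; g].
have [E16 E25 E34 E43] := elem_sym_recip7 t1.
rewrite -/s in E16 E25 E34 E43.
have E1 : elem_sym 1 s = - 2 by rewrite -p1 /s /=; ring.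
have E2 : elem_sym 2 s = 3.
  apply: (@mulfI _ 2); rewrite ?pnatr_eq0 //.
  have -> : 2 * elem_sym 2 s = elem_sym 1 s ^+ 2 - (- 2) by rewrite -p2 /s /=; ring.
  by rewrite E1; ring.
have E4 : elem_sym 4 s = - 3 - 2 * elem_sym 3 s.
  apply: (@mulfI _ 4); rewrite ?pnatr_eq0 //.
  have -> : 4 * elem_sym 4 s = elem_sym 1 s ^+ 4 - 4 * elem_sym 1 s ^+ 2 * elem_sym 2 s
      + 2 * elem_sym 2 s ^+ 2 + 4 * elem_sym 1 s * elem_sym 3 s - (-2).
    by rewrite -p4 /s /=; ring.
  by rewrite E1 E2; ring.
set v := elem_sym 7 s in E16 E25 E34 E43.
have v1 : `|v| = 1.
  have -> : v = a * b * c * d * e * f * g by rewrite /v /s /=; ring.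
  by rewrite !normrM !t1 ?inE ?eqxx ?orbT // !mulr1.
(* [E43], [E4] and [E34] combine to e_3 = - 3 v + 6 + 4 e_3. *)
have E3 : elem_sym 3 s = v - 2.
  apply: (@mulfI _ 3); rewrite ?pnatr_eq0 //.
  have : elem_sym 3 s = v * (- 3 - 2 * (elem_sym 3 s)^*).
    by rewrite -{1}E43 E4 rmorphB rmorphM rmorphN !rmorph_nat.
  have -> : v * (- 3 - 2 * (elem_sym 3 s)^*) = - 3 * v - 2 * (v * (elem_sym 3 s)^*).
    ring.
  rewrite E34 E4 => E.
  have -> : 3 * elem_sym 3 s = 4 * elem_sym 3 s - elem_sym 3 s by ring.
  by rewrite {2}E; ring.
(* Any cube root of v serves: another choice only permutes the last three entries of
   [phase_list]. *)
pose r := 3.-root v; exists r.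
have r3 : r ^+ 3 = v by rewrite rootCK.
split.
  apply/eqP; rewrite -(@pexpr_eq1 _ _ 3) ?normr_ge0 //.
  by rewrite -normrX r3 v1.
apply: prod_XsubC_eq; rewrite prodXsubC7 /phase_list prodXsubC7 -/s.
have s1 : w + w ^+ 2 = -1 by rewrite -[LHS]subr0 -w2; ring.
have s2 : w * w ^+ 2 = 1.
  by rewrite -[LHS]addr0 -(mulr0 (1 - w)) -w2; ring.
have q1 : r + r * w + r * w ^+ 2 = 0 by rewrite -(mulr0 r) -w2; ring.
have q2 : r * (r * w) + r * (r * w ^+ 2) + r * w * (r * w ^+ 2) = 0.
  by rewrite -[RHS](mulr0 (r ^+ 2 * w)) -w2; ring.
have q3 : r * (r * w) * (r * w ^+ 2) = v.
  by rewrite -r3 -[RHS]mulr1 -s2; ring.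
(* After generalisation the list is a doubled pair [w], [u] and a triple [r], [y], [z]; its
   symmetric functions are computed from those of the pair and of the triple. *)
move: (w ^+ 2) s1 s2 q1 q2 q3 => u s1 s2.
move: (r * w) (r * u) => y z q1 q2 q3.
set s' := [:: w; _; _; _; _; _; _].
have E1' : elem_sym 1 s' = - 2.
  have -> : elem_sym 1 s' = 2 * (w + u) + (r + y + z) by rewrite /s' /=; ring.
  by rewrite s1 q1; ring.
have E2' : elem_sym 2 s' = 3.
  have -> : elem_sym 2 s' = (w + u) ^+ 2 + 2 * (w * u) + 2 * (w + u) * (r + y + z)
      + (r * y + r * z + y * z) by rewrite /s' /=; ring.
  by rewrite s1 s2 q1 q2; ring.
have E3' : elem_sym 3 s' = v - 2.
  have -> : elem_sym 3 s' = 2 * (w + u) * (w * u)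
      + ((w + u) ^+ 2 + 2 * (w * u)) * (r + y + z)
      + 2 * (w + u) * (r * y + r * z + y * z) + r * y * z
    by rewrite /s' /=; ring.
  by rewrite s1 s2 q1 q2 q3; ring.
have E4' : elem_sym 4 s' = 1 - 2 * v.
  have -> : elem_sym 4 s' = (w * u) ^+ 2 + 2 * (w + u) * (w * u) * (r + y + z)
      + ((w + u) ^+ 2 + 2 * (w * u)) * (r * y + r * z + y * z)
      + 2 * (w + u) * (r * y * z)
    by rewrite /s' /=; ring.
  by rewrite s1 s2 q1 q2 q3; ring.
have E5' : elem_sym 5 s' = 3 * v.
  have -> : elem_sym 5 s' = (w * u) ^+ 2 * (r + y + z)
      + 2 * (w + u) * (w * u) * (r * y + r * z + y * z)
      + ((w + u) ^+ 2 + 2 * (w * u)) * (r * y * z)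
    by rewrite /s' /=; ring.
  by rewrite s1 s2 q1 q2 q3; ring.
have E6' : elem_sym 6 s' = - 2 * v.
  have -> : elem_sym 6 s' = (w * u) ^+ 2 * (r * y + r * z + y * z)
      + 2 * (w + u) * (w * u) * (r * y * z)
    by rewrite /s' /=; ring.
  by rewrite s1 s2 q2 q3; ring.
have E7' : elem_sym 7 s' = v.
  have -> : elem_sym 7 s' = (w * u) ^+ 2 * (r * y * z) by rewrite /s' /=; ring.
  by rewrite s2 q3; ring.
rewrite E1' E2' E3' E4' E5' E6' E7' E1 E2 E3 E4 E3 -/v -E25 -E16 E1 E2.
rewrite rmorphN !rmorph_nat.
by congr (_ + _%:P * _ - _%:P * _ + _%:P * _ - _); ring.
Qed.
End Seven.

(** * The 2-design identity and orthogonality of the entrywise square *)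

(** The nine products of column i of B with row i of A form a basis of the 3 x 3 matrices, so the
    trace pairing expands through them by means of the inverse of their Gram matrix. Expanding G k j
    ^ 2, itself such a pairing, produces the sum of squares. *)
Lemma two_design (F : numFieldType) (A : 'M[F]_(9, 3)) (B : 'M[F]_(3, 9))
    (G := A *m B) :
  (forall i, G i i = 1) ->
  (forall i j, i != j -> G i j * G j i = 1 / 4) ->
  G *m G = 3 *: G ->
  forall k j, \sum_i (G k i * G i j) ^+ 2 = 3 / 2 * G k j ^+ 2.
Proof.
move=> G1 G4 GG k j.
(* The transposition in [P] makes the dot product of a row of [P] with a row of [Q] the trace of the
   product of the two rank-one matrices. *)
pose P : 'M[F]_9 := \matrix_i mxvec ((row i A)^T *m (col i B)^T).
pose Q : 'M[F]_9 := \matrix_i mxvec (col i B *m row i A).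
have GE i l : (row i A *m col l B) 0 0 = G i l.
  by rewrite !mxE; apply: eq_bigr => x _; rewrite !mxE.
clearbody G.
have pair i l i' l' :
  (mxvec ((row i A)^T *m (col l B)^T) *m (mxvec (col l' B *m row i' A))^T) 0 0
    = G i l' * G i' l.
  rewrite mxvec_dotmul trmxK mulmxA -mulmxA [in LHS]mxE big_ord1.
  by rewrite !GE.
(* N inverts the Gram matrix 3/4 I + 1/4 J of the projections; P being square,
   this makes the projections span all 3x3 matrices. *)
pose N : 'M[F]_9 := (4 / 3)%:M - const_mx (1 / 9).
have PQN : P *m Q^T *m N = 1%:M.
  have PQ : P *m Q^T = (3 / 4)%:M + const_mx (1 / 4).
    apply/matrixP => i l.
    transitivity (G i l * G l i).
      by rewrite -(pair i i l l) !mxE; apply: eq_bigr => x _; rewrite !mxE.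
    rewrite !mxE; case: eqVneq => [->|/G4 ->]; last by rewrite mulr0n add0r.
    by rewrite !G1 mulr1n; field.
  apply/matrixP => i l.
  rewrite PQ mulmxBr mul_mx_scalar scalerDr mulmxDl mul_scalar_mx !mxE.
  under eq_bigr do rewrite !mxE.
  rewrite sumr_const card_ord.
  by case: (i == l); rewrite ?mulr1n ?mulr0n; field.
have QNP : Q^T *m N *m P = 1%:M by apply: mulmx1C; rewrite mulmxA.
(* Both vectors come from the product of column j of [B] with row k of [A]; their pairing is G k j ^
   2, and [QNP] inserts the basis into it. *)
pose a : 'rV[F]_9 := mxvec ((row k A)^T *m (col j B)^T).
pose b : 'rV[F]_9 := mxvec (col j B *m row k A).
have abE : (a *m Q^T *m N *m (P *m b^T)) 0 0 = G k j ^+ 2.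
  by rewrite mulmxA -(mulmxA a) -(mulmxA a) QNP mulmx1 [LHS]pair.
pose u : 'rV[F]_9 := \row_i (G k i * G i j).
have aQ : a *m Q^T = u.
  apply/rowP => i; rewrite !mxE -(pair k j i i) !mxE.
  by apply: eq_bigr => x _; rewrite !mxE.
have Pb : P *m b^T = u^T.
  apply/colP => i; rewrite !mxE mulrC -(pair i i k j) !mxE.
  by apply: eq_bigr => x _; rewrite !mxE.
(* The entries of [u] add up to 3 G k j, the (k, j) entry of G^2; hence the constant 1/3. *)
have su : u *m const_mx (1 / 9) = const_mx (G k j / 3) :> 'rV_9.
  have := congr1 (fun X : 'M_9 => X k j) GG; rewrite !mxE => GGkj.
  apply/rowP => i; rewrite !mxE.
  under eq_bigr do rewrite !mxE; rewrite -mulr_suml GGkj.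
  by field.
have : ((4 / 3 *: u - const_mx (G k j / 3)) *m u^T) 0 0 = G k j ^+ 2.
  by rewrite -abE aQ Pb mulmxBr mul_mx_scalar su.
rewrite mulmxBl -scalemxAl !mxE.
under eq_bigr do rewrite !mxE -expr2.
under [X in _ - X]eq_bigr do rewrite !mxE.
have := congr1 (fun X : 'M_9 => X k j) GG; rewrite !mxE => GGkj.
rewrite -mulr_sumr GGkj => E.
apply: (@mulfI _ (4 / 3)); first by rewrite mulf_neq0 ?invr_eq0 ?pnatr_eq0.
by rewrite -[LHS](subrK (G k j / 3 * (3 * G k j))) E; field.
Qed.

(** In a full-rank factorisation, G^2 = 3 G forces the product in the reverse order to be 3 I, so
    the trace is three times the rank. *)
Lemma rank3_factor (F : numFieldType) (G : 'M[F]_9) :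
  G *m G = 3 *: G -> \tr G = 9 ->
  exists (A : 'M[F]_(9, 3)) (B : 'M[F]_(3, 9)), G = A *m B.
Proof.
move=> GG trG.
have : exists (A : 'M[F]_(9, \rank G)) (B : 'M[F]_(\rank G, 9)), G = A *m B.
  by exists (col_base G), (row_base G); rewrite mulmx_base.
suff -> : \rank G = 3 by [].
have BA : row_base G *m col_base G = 3%:M.
  apply: (row_full_inj (col_base_full G)); apply: (row_free_inj (row_base_free G)).
  rewrite mulmxA mulmx_base -mulmxA mulmx_base GG mul_mx_scalar -scalemxAl.
  by rewrite mulmx_base.
move: trG; rewrite -{1}(mulmx_base G) mxtrace_mulC BA mxtrace_scalar => E.
have /eqP : (3 * \rank G)%:R = 9%:R :> F by rewrite natrM mulr_natr.
by rewrite eqr_nat (@eqn_pmul2l 3 _ 3) // => /eqP.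
Qed.

(* G = (3I - H)/2 is 3 times a projection of trace 3, so it factors through
   F^3 and the 2-design identity for it says that H o H is again orthogonal. *)
Lemma square_orthogonal (F : numFieldType) (h : 'I_9 -> 'I_9 -> F) :
  (forall i, h i i = 1) -> (forall i j, h i j * h j i = 1) ->
  (forall i j, i != j -> \sum_k h i k * h k j = 0) ->
  forall i j, i != j -> \sum_k (h i k * h k j) ^+ 2 = 0.
Proof.
move=> h1 hV ho i j ij.
pose H : 'M[F]_9 := \matrix_(k, l) h k l.
have HH : H *m H = 9%:M.
  apply/matrixP => k l; rewrite !mxE; under eq_bigr do rewrite !mxE.
  case: eqVneq => [->|/ho -> //].
  by under eq_bigr do rewrite hV; rewrite sumr_const card_ord mulr1n.
pose G : 'M[F]_9 := (3 / 2)%:M - (1 / 2) *: H.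
have GE k l : G k l = (if k == l then 1 else - (1 / 2)) * h k l.
  by rewrite !mxE; case: eqVneq => [->|_]; rewrite ?mulr1n ?mulr0n ?h1; field.
have GG : G *m G = 3 *: G.
  rewrite /G mulmxBl !mulmxBr mul_scalar_mx mul_mx_scalar mul_scalar_mx.
  rewrite -!scalemxAl -!scalemxAr HH.
  apply/matrixP => k l; rewrite !mxE.
  by case: (k == l); rewrite ?mulr1n ?mulr0n; field.
have trG : \tr G = 9.
  rewrite /mxtrace; under eq_bigr do rewrite GE eqxx mul1r h1.
  by rewrite sumr_const card_ord.
have Gd k : G k k = 1 by rewrite GE eqxx h1 mulr1.
have Gh k l : k != l -> G k l * G l k = 1 / 4.
  rewrite !GE [l == k]eq_sym => /negPf ->.
  by rewrite mulrACA hV; field.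
clearbody G.
have [A [B GAB]] := rank3_factor GG trG.
rewrite GAB in GE GG Gd Gh.
have := two_design Gd Gh GG i j; rewrite -GAB in GE *.
(* With x = h i j, the indices i and j contribute x^2 / 4 each to the sum for [G], but x^2 / 16 each
   to 1/16 of the sum for [h]; the term 3/8 x^2 on the right is exactly the difference. *)
rewrite (bigD1 i) // (bigD1 j) 1?eq_sym //=.
rewrite (eq_bigr (fun k => 1 / 16 * (h i k * h k j) ^+ 2)); last first.
  move=> k /andP[ki kj]; rewrite !GE [i == k]eq_sym (negPf ki) (negPf kj).
  by field.
rewrite -mulr_sumr !GE !eqxx (negPf ij) !h1 => E.
rewrite (bigD1 i) // (bigD1 j) 1?eq_sym //= !h1.
move: (\sum_(_ | _) _) E => S E.
apply: (@mulfI _ (1 / 16)).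
  by rewrite mulf_neq0 ?invr_eq0 ?pnatr_eq0 ?oner_eq0.
set x := h i j in E *.
have -> : 1 / 16 * ((1 * x) ^+ 2 + ((x * 1) ^+ 2 + S)) =
  ((1 * 1 * (- (1 / 2) * x)) ^+ 2 + ((- (1 / 2) * x * (1 * 1)) ^+ 2 + 1 / 16 * S))
  - 3 / 2 * (- (1 / 2) * x) ^+ 2 by field.
by rewrite E subrr mulr0.
Qed.

(** * Hermitian phase matrices and the triple products along an edge *)

(** A self-adjoint complex Hadamard matrix of order 9 with unit diagonal; [pm_herm] and [pm_inv]
    together make the entries unimodular. *)
Record phase_matrix (C : numClosedFieldType) (h : 'I_9 -> 'I_9 -> C) : Prop :=
  PhaseMatrix {
    pm_diag : forall i, h i i = 1;
    pm_herm : forall i j, (h i j)^* = h j i;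
    pm_inv : forall i j, h i j * h j i = 1;
    pm_orth : forall i j, i != j -> \sum_k h i k * h k j = 0 }.

(** The Bargmann invariant of three vectors, unchanged by unimodular rescaling. In a phase matrix,
    the value 1 at distinct indices says that the three vectors are dependent. *)
Definition triple (C : numClosedFieldType) (h : 'I_9 -> 'I_9 -> C) i j k : C :=
  h i j * h j k * h k i.

Section CubeRoot.
Variables (C : numClosedFieldType) (w : C).
Hypothesis w2 : w ^+ 2 + w + 1 = 0.

Lemma cube_root1 : w ^+ 3 = 1.
Proof. by apply/eqP; rewrite -subr_eq0 -(mulr0 (w - 1)) -w2; apply/eqP; ring. Qed.

Lemma sqr_cube_root : w ^+ 2 = - 1 - w.
Proof. by apply/eqP; rewrite -subr_eq0 -w2; apply/eqP; ring. Qed.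

Lemma sqr_cube_root_eq0 : (w ^+ 2) ^+ 2 + w ^+ 2 + 1 = 0.
Proof. by rewrite -(mulr0 (w ^+ 2 - w + 1)) -w2; ring. Qed.

Lemma cube_root_neq1 : w != 1.
Proof.
apply/eqP => w1; move: w2; rewrite w1 => /eqP.
by rewrite (_ : _ + 1 = 3) ?pnatr_eq0 //; ring.
Qed.

Lemma cube_root_sqr_neq : w != w ^+ 2.
Proof.
apply: contra_neq cube_root_neq1 => ww.
by rewrite -cube_root1 exprS -ww -expr2 -ww.
Qed.

Lemma cube_root_sqr_neq1 : w ^+ 2 != 1.
Proof.
apply: contra_neq cube_root_neq1 => ww.
by rewrite -cube_root1 exprSr ww mul1r.
Qed.

Lemma cube_root_neq0 : w != 0.
Proof.
by apply/eqP => w0; move/eqP: cube_root1; rewrite w0 expr0n /= eq_sym oner_eq0.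
Qed.

Lemma cube_root_norm : `|w| = 1.
Proof.
by apply/eqP; rewrite -(@pexpr_eq1 _ _ 3) ?normr_ge0 // -normrX cube_root1 normr1.
Qed.

Lemma cube_root_conj : w^* = w ^+ 2.
Proof.
have w0 := cube_root_neq0.
rewrite -[RHS]mul1r -(mulVf w0) -mulrA -exprS cube_root1 mulr1.
by rewrite invC_norm cube_root_norm expr1n invr1 mul1r.
Qed.

(** Serves to exclude kernel relations in which a phase is repeated. *)
Lemma cube_root_twice : 2 * w + 1 != 0 /\ 2 + w != 0.
Proof.
have n3 : (3 : C) != 0 by rewrite pnatr_eq0.
split; apply: contraNneq n3 => E.
  have -> : (3 : C) = 4 * (w ^+ 2 + w + 1) - (2 * w + 1) * (2 * w + 1) by ring.
  by rewrite w2 E !mulr0 subr0.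
have -> : (3 : C) = (w ^+ 2 + w + 1) - (2 + w) * (w - 1) by ring.
by rewrite w2 E mul0r subr0.
Qed.

(** Inserting b = - 1 - a into |b| = 1 gives a + conj a = - 1, hence a^2 + a + 1 = 0. *)
Lemma unimodular_sum0 (a b : C) :
  a * a^* = 1 -> b * b^* = 1 -> 1 + a + b = 0 ->
  (a = w /\ b = w ^+ 2) \/ (a = w ^+ 2 /\ b = w).
Proof.
move=> a1 b1 ab.
have bE : b = - 1 - a by rewrite -[LHS]subr0 -ab; ring.
have : (a - w) * (a - w ^+ 2) = 0.
  have -> : (a - w) * (a - w ^+ 2) =
     a ^+ 2 + a + w ^+ 3 - a * (w ^+ 2 + w + 1) by ring.
  rewrite w2 cube_root1 mulr0 subr0.
  move: b1; rewrite bE rmorphB rmorphN rmorph1 => b1.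
  have -> : a ^+ 2 + a + 1 = a * ((-1 - a) * (-1 - a^*) - 1) + a * (1 - a * a^*) +
    (1 - a * a^*) by ring.
  by rewrite b1 a1 !subrr !mulr0 !addr0.
move/eqP; rewrite mulf_eq0 !subr_eq0 => /orP[]/eqP aE; [left|right]; split=> //.
  by rewrite bE aE sqr_cube_root.
by rewrite bE aE sqr_cube_root; ring.
Qed.

Lemma count_phase_list (p : pred C) r :
  count p (phase_list w r) =
  (2 * p w + 2 * p (w ^+ 2) + (p r + p (r * w)%R + p (r * w ^+ 2)%R))%N.
Proof. by rewrite /=; case: (p w); case: (p (w ^+ 2)); rewrite !addn0 ?addnA. Qed.

Section Edge.
Variable h : 'I_9 -> 'I_9 -> C.
Hypothesis hP : phase_matrix h.
Local Notation T := (triple h).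

Lemma pm_norm i j : `|h i j| = 1.
Proof.
apply/eqP; rewrite -(@pexpr_eq1 _ _ 2) ?normr_ge0 //.
by rewrite normCK (pm_herm hP) (pm_inv hP).
Qed.

(** Orthogonality of the rows of h and of its entrywise second and fourth powers gives the power
    sums for [seven_phases]. Counting by arbitrary predicates expresses equality of multisets
    without ordering the indices. *)
Lemma edge_count i j : i != j ->
  exists r, forall p : pred C,
    #|[set k | [&& k != i, k != j & p (T i j k)]]| = count p (phase_list w r).
Proof.
move=> ij.
(* The terms k = i and k = j are both h j i ^ n; multiplied by h i j ^ n they add up to 2. *)
have sum0 n : \sum_k (h j k * h k i) ^+ n = 0 ->
    \sum_(k | (k != i) && (k != j)) T i j k ^+ n = - 2.
  rewrite (bigD1 i) // (bigD1 j) 1?eq_sym //= !(pm_diag hP) mul1r mulr1.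
  rewrite addrA -mulr2n => /(congr1 (fun x => h i j ^+ n * x)).
  rewrite mulrDr mulr0 mulr_sumr mulrnAr -exprMn (pm_inv hP) expr1n.
  move/eqP; rewrite addrC addr_eq0 => /eqP E; rewrite -[RHS]E.
  by apply: eq_bigr => k _; rewrite -exprMn mulrA.
pose s := enum [pred k | (k != i) && (k != j)].
have sz : size (map (T i j) s) = 7%N.
  rewrite size_map -cardE.
  have := cardC (pred2 i j); rewrite card2 ij card_ord.
  move=> /eqP; rewrite (@eqn_add2l 2 _ 7%N) => /eqP E; rewrite -[RHS]E.
  by apply: eq_card => k; rewrite !inE negb_or.
have tn : {in map (T i j) s, forall x, `|x| = 1}.
  by move=> _ /mapP[k _ ->]; rewrite !normrM !pm_norm !mulr1.
have sumE n : \sum_(x <- map (T i j) s) x ^+ n =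
    \sum_(k | (k != i) && (k != j)) T i j k ^+ n.
  by rewrite big_map big_enum.
have ji : j != i by rewrite eq_sym.
have o1 := pm_orth hP.
have o2 := square_orthogonal (pm_diag hP) (pm_inv hP) o1.
(* [square_orthogonal] is applied once more, to the entrywise square. *)
have o4 : \sum_k (h j k * h k i) ^+ 4 = 0.
  have := @square_orthogonal _ (fun i j => h i j ^+ 2) _ _ _ j i ji.
  under eq_bigr do rewrite -exprMn -exprM; apply.
  - by move=> k; rewrite (pm_diag hP) expr1n.
  - by move=> k l; rewrite -exprMn (pm_inv hP) expr1n.
  - move=> k l kl; rewrite -[RHS](o2 _ _ kl).
    by apply: eq_bigr => m _; rewrite exprMn.
have [||| r [_ pe]] := seven_phases w2 sz tn.
- by have := sum0 1%N (o1 _ _ ji); rewrite -sumE.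
- by rewrite sumE; apply: sum0; exact: o2.
- by rewrite sumE; apply: sum0; exact: o4.
exists r => p; rewrite -(seq.permP pe) count_map -size_filter cardE.
rewrite /s /enum_mem -filter_predI.
by congr size; apply: eq_filter => k; rewrite !inE /= andbA andbC.
Qed.

Lemma tripleii i j : T i j i = 1.
Proof. by rewrite /triple (pm_inv hP) (pm_diag hP) mulr1. Qed.

Lemma tripleij i j : T i j j = 1.
Proof. by rewrite /triple (pm_diag hP) mulr1 (pm_inv hP). Qed.

Lemma cube_root_cases r : r ^+ 3 = 1 -> [\/ r = 1, r = w | r = w ^+ 2].
Proof.
move=> r3; have : (r - 1) * ((r - w) * (r - w ^+ 2)) = 0.
  have -> : (r - 1) * ((r - w) * (r - w ^+ 2)) =
    r ^+ 3 - 1 - (r - 1) * r * (w ^+ 2 + w + 1) + (r - 1) * (w ^+ 3 - 1) by ring.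
  by rewrite w2 cube_root1 r3 subrr !mulr0 subr0 addr0.
move/eqP; rewrite !mulf_eq0 !subr_eq0.
by case/or3P => /eqP; [constructor 1 | constructor 2 | constructor 3].
Qed.

Lemma count_phase_list1 (p : pred C) r : r ^+ 3 = 1 ->
  count p (phase_list w r) = (p 1%R + 3 * p w + 3 * p (w ^+ 2)%R)%N.
Proof.
have w3 : w * w ^+ 2 = 1 by rewrite -exprS cube_root1.
rewrite count_phase_list => /cube_root_cases[] ->.
- by rewrite !mul1r; lia.
- by rewrite w3 -expr2; lia.
- by rewrite [_ * w]mulrC w3 -exprD (exprD w 3 1) cube_root1 mul1r expr1; lia.
Qed.

Definition full_edge i j := forall k, T i j k ^+ 3 = 1.

(** The cases are r^3 = 1 and r^3 <> 1 for the r of [edge_count]. In the first, the seven values are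
    1 once and each primitive cube root three times; in the second, only r, r w and r w^2 have a
    nontrivial cube, the same for all three, and 1 is not attained. *)
Lemma edge_dichotomy i j : i != j ->
  [/\ full_edge i j,
      forall c, c ^+ 2 + c + 1 = 0 -> #|[set k | T i j k == c]| = 3%N
    & exists k, [/\ k != i, k != j & T i j k = 1]] \/
  [/\ #|[set k | T i j k ^+ 3 != 1]| = 3%N,
      forall k l, T i j k ^+ 3 != 1 -> T i j l ^+ 3 != 1 ->
        T i j k ^+ 3 = T i j l ^+ 3
    & forall k, k != i -> k != j -> T i j k != 1].
Proof.
move=> ij; have [r cE] := edge_count ij.
(* At k = i and k = j the triple product is 1, so a predicate false at 1 counts the same over all
   nine indices as over the seven. *)
have cardT (p : pred C) : ~~ p 1 ->
    #|[set k | p (T i j k)]| = count p (phase_list w r).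
  move=> p1; rewrite -cE; apply: eq_card => k; rewrite !inE.
  case: eqVneq => [->|_]; first by rewrite tripleii (negPf p1).
  by case: eqVneq => [->|//]; rewrite tripleij (negPf p1).
pose ncube (x : C) := x ^+ 3 != 1.
have ncube1 : ~~ ncube 1 by rewrite /ncube expr1n eqxx.
have w3 := cube_root1; have w1 := cube_root_neq1.
have w21 := cube_root_sqr_neq1.
have w23 : (w ^+ 2) ^+ 3 = 1 by rewrite exprAC w3 expr1n.
have [r3|r3] := eqVneq (r ^+ 3) 1; [left|right].
  split.
  - move=> k; apply/eqP; apply: contraT => k3.
    have : #|[set k | T i j k ^+ 3 != 1]| = 0%N.
      rewrite (cardT ncube) // count_phase_list1 // /ncube.
      by rewrite expr1n w3 w23 eqxx.
    by move/cards0_eq/setP/(_ k); rewrite !inE k3.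
  - move=> c cw; have c3 : c ^+ 3 = 1.
      by rewrite -[LHS](subrK 1) -[RHS]add0r -(mulr0 (c - 1)) -cw; ring.
    have c1 : c != 1.
      apply: contra_eq_neq cw => ->.
      by rewrite (_ : _ + 1 = 3) ?pnatr_eq0 //; ring.
    rewrite (cardT (pred1 c)); last by rewrite /= eq_sym.
    rewrite count_phase_list1 //= [1 == c]eq_sym (negPf c1).
    have ww := cube_root_sqr_neq.
    case/cube_root_cases: c3 c1 => -> => [|_|_]; first by rewrite eqxx.
      by rewrite eqxx (eq_sym _ w) (negPf ww).
    by rewrite eqxx (negPf ww).
  - have : #|[set k | [&& k != i, k != j & T i j k == 1]]| = 1%N.
      transitivity (count (pred1 1) (phase_list w r)); first exact: cE.
      by rewrite count_phase_list1 //= eqxx (negPf w1) (negPf w21).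
    move/eqP/cards1P => [k /setP/(_ k)]; rewrite !inE eqxx.
    by case/and3P => ki kj /eqP; exists k.
have r3w k : (r * w ^+ k) ^+ 3 = r ^+ 3.
  by rewrite exprMn -exprM mulnC exprM w3 expr1n mulr1.
split.
- rewrite (cardT ncube) // /ncube.
  by rewrite count_phase_list -(expr1 w) !r3w expr1 w3 w23 eqxx r3.
- suff E k : T i j k ^+ 3 != 1 -> T i j k ^+ 3 = r ^+ 3 by move=> k l /E-> /E->.
  move=> k3; apply/eqP; apply: contraT => kr.
  pose p x := (x ^+ 3 != 1) && (x ^+ 3 != r ^+ 3).
  have : #|[set k | p (T i j k)]| = 0%N.
    rewrite (cardT p) /p ?expr1n ?eqxx //.
    by rewrite count_phase_list -(expr1 w) !r3w expr1 w3 w23 !eqxx andbF.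
  by move/cards0_eq/setP/(_ k); rewrite !inE /p k3 kr.
move=> k ki kj; apply/eqP => k1.
have : #|[set k | [&& k != i, k != j & T i j k == 1]]| = 0%N.
  transitivity (count (pred1 1) (phase_list w r)); first exact: cE.
  have neq1 x : x ^+ 3 = r ^+ 3 -> (x == 1) = false.
    by move=> x3; apply: contraNF r3 => /eqP x1; rewrite -x3 x1 expr1n.
  rewrite count_phase_list /= (negPf w1) (negPf w21) -(expr1 w) !neq1 //.
by move/cards0_eq/setP/(_ k); rewrite !inE ki kj k1 eqxx.
Qed.
End Edge.
End CubeRoot.

(** * The pattern of the entrywise cubes *)

(** The support [S i], where row i differs from 1, is [L ord0 i]; so it has 0 or 3 elements and row
    i is constant on it. Counting shows that nonempty supports coincide or are disjoint, and as none
    contains [ord0] there is room for only two. *)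
Lemma bipartite_cocycle (F : fieldType) (f : 'I_9 -> 'I_9 -> F)
    (L := fun i j => [set k | f i j * f j k * f k i != 1]) :
  (forall i, f i i = 1) -> (forall i j, f i j * f j i = 1) ->
  (forall k, f ord0 k = 1) ->
  (forall i j, i != j -> #|L i j| = 0 \/ #|L i j| = 3)%N ->
  (forall i j, i != j -> {in L i j &, forall k l,
     f i j * f j k * f k i = f i j * f j l * f l i}) ->
  (forall i j, f i j = 1) \/
  exists (A B : {set 'I_9}) (v : F),
    [/\ #|A| = 3%N, #|B| = 3%N, [disjoint A & B] & ord0 \notin A :|: B] /\
    v != 1 /\
    forall i j, f i j = if (i \in A) && (j \in B) then v
                        else if (i \in B) && (j \in A) then v^-1 else 1.
Proof.
move=> f1 fV f0 cardL constL.
have f0' k : f k ord0 = 1 by rewrite -[LHS]mul1r -(f0 k) fV.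
have fE i j : f j i = (f i j)^-1.
  have f_n0 : f i j != 0.
    by apply/eqP => fij; move/eqP: (fV i j); rewrite fij mul0r eq_sym oner_eq0.
  by apply: (mulfI f_n0); rewrite fV divff.
pose S i := [set k | f i k != 1].
have Ssym i k : (k \in S i) = (i \in S k) by rewrite !inE fE invr_eq1.
have S0 i : ord0 \notin S i by rewrite inE f0' eqxx.
have L0 i : L ord0 i = S i by apply/setP => k; rewrite !inE f0 f0' mul1r mulr1.
have neq0 i k : k \in S i -> ord0 != i.
  by apply: contraTneq => <-; rewrite inE f0 eqxx.
have cardS i k : k \in S i -> #|S i| = 3%N.
  move=> ki; case: (cardL _ _ (neq0 _ _ ki)); rewrite L0 // => /cards0_eq Si.
  by rewrite Si inE in ki.
have constS i : {in S i &, forall k l, f i k = f i l}.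
  move=> k l ki li; have := constL _ _ (neq0 _ _ ki) k l.
  by rewrite L0 !f0 !f0' !mul1r !mulr1; apply.
have dichot i j k l : k \in S i -> l \in S j -> S i = S j \/ [disjoint S i & S j].
  have [->|ij] := eqVneq i j; first by left.
  (* M is a level set of k |-> f j k * f k i, and these have 3, 6 or 9 elements;
     on the other hand |M| is 3 + t or 3 + 2t for t = |S i :&: S j|. *)
  move=> ki lj; pose M := [set k | f j k * f k i == 1].
  have Mcard : [\/ #|M| = 3, #|M| = 6 | #|M| = 9]%N.
    have [fij|fij] := eqVneq (f i j) 1.
      have <- : ~: L i j = M.
        by apply/setP => m; rewrite !inE fij mul1r negbK.
      have := cardsC (L i j); rewrite card_ord.
      by case: (cardL _ _ ij) => -> ?; [constructor 3 | constructor 2]; lia.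
    have L0ij : ord0 \in L i j by rewrite inE f0 f0' !mulr1.
    (* As [ord0] lies in [L i j] with product f i j, constancy forces f j m * f m i = 1 on all of
       [L i j]. *)
    have -> : M = L i j.
      apply/setP => m; apply/idP/idP; rewrite !inE.
        by rewrite -mulrA => /eqP ->; rewrite mulr1.
      move=> mL; have /(_ m ord0) := constL _ _ ij.
      rewrite !inE mL f0 f0' !mulr1 fij => /(_ isT isT).
      rewrite -mulrA -[RHS]mulr1 => /mulfI-> //.
      by apply/eqP => f_0; move/eqP: (fV i j); rewrite f_0 mul0r eq_sym oner_eq0.
    case: (cardL _ _ ij) => cL; last by constructor 1.
    by move/cards0_eq: cL => cL; rewrite cL inE in L0ij.
  have cU := cardsUI (S i) (S j); have cC := cardsC (S i :|: S j).
  rewrite (cardS _ _ ki) (cardS _ _ lj) in cU; rewrite card_ord in cC.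
  have tI : (#|S i :&: S j| <= 3)%N.
    by have := subset_leq_card (subsetIl (S i) (S j)); rewrite (cardS _ _ ki).
  have t3 : #|S i :&: S j| = 0%N \/ #|S i :&: S j| = 3%N.
    (* The factor f m i is the inverse of f i m, so an index in exactly one of the two supports is
       not in [M]. *)
    have inM m : m \in M = ((m \notin S i :|: S j) ||
        (m \in S i :&: S j) && (f j m == f i m)).
      rewrite !inE (fE i m).
      have [->|mi] := eqVneq (f i m) 1; first by rewrite invr1 mulr1 negbK orbF.
      have [->|mj] := eqVneq (f j m) 1; first by rewrite mul1r invr_eq1 (negPf mi).
      have fim : f i m != 0.
        by apply: contra_eq_neq (fV i m) => ->; rewrite mul0r eq_sym oner_eq0.
      have fim' : (f i m)^-1 != 0 by rewrite invr_eq0.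
      by rewrite -[RHS](inj_eq (mulIf fim')) divff.
    have [/existsP[m /andP[mI fm]]|/existsPn noI] :=
        boolP [exists m, (m \in S i :&: S j) && (f j m == f i m)].
      have ME : M = ~: (S i :|: S j) :|: (S i :&: S j).
        apply/setP => n; rewrite inM [RHS]in_setU in_setC; congr (_ || _).
        apply: andb_idr; rewrite !in_setI in mI * => /andP[ni nj].
        case/andP: mI => mi mj.
        by rewrite (constS _ _ _ ni mi) (constS _ _ _ nj mj).
      have : #|M| = (#|~: (S i :|: S j)| + #|S i :&: S j|)%N.
        rewrite ME cardsU (_ : _ :&: (_ :&: _) = set0) ?cards0 ?subn0 //.
        apply/setP => n; rewrite !inE.
        by case: (_ == _); case: (_ == _).
      by case: Mcard => ->; lia.
    have ME : M = ~: (S i :|: S j).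
      by apply/setP => n; rewrite inM (negPf (noI n)) orbF in_setC.
    by rewrite ME in Mcard; case: Mcard; lia.
  case: t3 => t3; [right|left].
    by rewrite -setI_eq0 -cards_eq0 t3.
  have Ii : S i :&: S j = S i.
    by apply/eqP; rewrite eqEcard subsetIl t3 (cardS _ _ ki).
  by apply/eqP; rewrite eqEcard -{1}Ii subsetIr (cardS _ _ ki) (cardS _ _ lj).
have [/existsP[i /existsP[j ij]]|none] := boolP [exists i, exists j, j \in S i];
    last first.
  left=> i j; apply/eqP; apply: contraNT none => fij.
  by apply/existsP; exists i; apply/existsP; exists j; rewrite inE.
right; exists (S j), (S i), (f i j).
have ji : i \in S j by rewrite Ssym.
have ii : i \notin S i by rewrite inE f1 eqxx.
have dij : [disjoint S j & S i].
  by case: (dichot _ _ _ _ ji ij) => // E; rewrite -E ji in ii.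
have shared k l m : m \in S k -> m \in S l -> S k = S l.
  move=> mk ml; case: (dichot _ _ _ _ mk ml) => // /disjointFr /(_ mk).
  by rewrite ml.
have Sj a : a \in S j -> S a = S i.
  by rewrite Ssym => aj; apply: shared aj ij.
have Si b : b \in S i -> S b = S j.
  by rewrite Ssym => bi; apply: shared bi ji.
have Sout k : k \notin S j :|: S i -> S k = set0.
  rewrite in_setU negb_or => /andP[kj ki]; apply/setP => l; rewrite in_set0.
  apply/negP => lk.
  have dj : [disjoint S j & S k].
    case: (dichot _ _ _ _ ji lk) => // E.
    by move: ki; rewrite Ssym -E ji.
  have di : [disjoint S i & S k].
    case: (dichot _ _ _ _ ij lk) => // E.
    by move: kj; rewrite Ssym -E ij.
  (* Three disjoint supports would fill all nine indices, yet [ord0] lies in none. *)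
  have : #|S j :|: S i :|: S k| = 9%N.
    rewrite cardsU (_ : _ :&: S k = set0); last first.
      by rewrite setIUl !disjoint_setI0 // setU0.
    rewrite cardsU (_ : S j :&: _ = set0) ?cards0; last first.
      exact: disjoint_setI0.
    by rewrite (cardS _ _ ij) (cardS _ _ ji) (cardS _ _ lk).
  move=> c9; have /eqP/setP/(_ ord0) : S j :|: S i :|: S k == setT.
    by rewrite eqEcard subsetT cardsT card_ord c9.
  by rewrite !in_setU in_setT !(negPf (S0 _)).
split; first by rewrite (cardS _ _ ij) (cardS _ _ ji) in_setU !(negPf (S0 _)).
split; first by move: ij; rewrite inE.
(* Move along row a from b to j, then along row j from a to i: f a b = f a j = 1 / f j a = 1 / f j i
   = f i j. *)
have fAB a b : a \in S j -> b \in S i -> f a b = f i j.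
  move=> aj bi; have Sa := Sj a aj.
  have bSa : b \in S a by rewrite Sa.
  have jSa : j \in S a by rewrite Sa.
  by rewrite (constS a b j bSa jSa) fE (constS j a i aj ji) -fE.
move=> a b.
have nS : b \notin S a -> f a b = 1 by rewrite inE negbK => /eqP.
have [aj|aj] /= := boolP (a \in S j).
  have [bi|bi] /= := boolP (b \in S i); first exact: fAB.
  rewrite (disjointFr dij aj) /=; apply: nS; rewrite Sj //.
have [ai|ai] /= := boolP (a \in S i).
  have [bj|bj] /= := boolP (b \in S j); first by rewrite fE fAB.
  by apply: nS; rewrite Si.
by apply: nS; rewrite Sout ?in_set0 // in_setU negb_or aj.
Qed.

(** * Dependent triples and the partition into three of them *)

Section DependentTriples.
Variables (C : numClosedFieldType) (h : 'I_9 -> 'I_9 -> C).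
Hypothesis hP : phase_matrix h.
Local Notation T := (triple h).

(* If c is the (conjugate) phase vector of the dependent triple, then H c has
   squared norm 27, all of which is already carried by the three coordinates
   i, j, k. *)
Lemma dependent_kernel i j k l :
  uniq [:: l; i; j; k] -> T i j k = 1 -> h l i + h l j * h j i + h l k * h k i = 0.
Proof.
rewrite /= !inE !negb_or => /and3P[/and3P[li lj lk] /andP[ij ik] /andP[jk _]] Tijk.
have hs a b : \sum_m h a m * h m b = (a == b)%:R * 9.
  case: eqVneq => [->|/(pm_orth hP)->]; last by rewrite mul0r.
  under eq_bigr do rewrite (pm_inv hP).
  by rewrite sumr_const card_ord mul1r.
pose y m := h m i + h m j * h j i + h m k * h k i.
have yE m : y m * (y m)^* = `|y m| ^+ 2 by rewrite normCK.
have ys a : \sum_m h a m * y m =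
    ((a == i)%:R + (a == j)%:R * h j i + (a == k)%:R * h k i) * 9.
  rewrite !mulrDl !(mulrAC _ _ 9) -!hs !mulr_suml -!big_split /=.
  by apply: eq_bigr => m _; rewrite /y; ring.
have yc m : (y m)^* = h i m + h i j * h j m + h i k * h k m.
  rewrite /y !rmorphD !rmorphM /= !(pm_herm hP); ring.
have sum_y : \sum_m `|y m| ^+ 2 = 27.
  transitivity (\sum_m h i m * y m + h i j * (\sum_m h j m * y m) +
     h i k * (\sum_m h k m * y m)).
    rewrite !mulr_sumr -!big_split /=; apply: eq_bigr => m _.
    by rewrite -yE yc; ring.
  rewrite !ys !eqxx (eq_sym j i) (eq_sym k i) (eq_sym k j).
  rewrite (negPf ij) (negPf ik) (negPf jk) !mul0r !addr0 !add0r !mul1r.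
  by rewrite !mulrA !(pm_inv hP); ring.
have Tjik : h j k * h k i = h j i.
  by rewrite -[LHS]mul1r -(pm_inv hP j i) -[RHS]mulr1 -Tijk /triple; ring.
have Tkij : h k j * h j i = h k i.
  by rewrite -Tjik mulrA (pm_inv hP) mul1r.
have norm9 (z c : C) : z = 3 * c -> c * c^* = 1 -> `|z| ^+ 2 = 9.
  by move=> -> cc; rewrite normCK rmorphM rmorph_nat mulrACA cc; ring.
have yi : `|y i| ^+ 2 = 9.
  apply: (norm9 _ 1); last by rewrite rmorph1 mulr1.
  by rewrite /y (pm_diag hP) !(pm_inv hP); ring.
have yj : `|y j| ^+ 2 = 9.
  apply: (norm9 _ (h j i)); last by rewrite (pm_herm hP) (pm_inv hP).
  by rewrite /y (pm_diag hP) Tjik; ring.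
have yk : `|y k| ^+ 2 = 9.
  apply: (norm9 _ (h k i)); last by rewrite (pm_herm hP) (pm_inv hP).
  by rewrite /y (pm_diag hP) Tkij; ring.
move: sum_y; rewrite (bigD1 i) //= (bigD1 j) 1?eq_sym //=.
rewrite (bigD1 k) /= 1?eq_sym ?ik 1?eq_sym ?jk // yi yj yk.
rewrite (_ : 27 = 9 + (9 + (9 + 0))) => [/addrI/addrI/addrI y0|]; last by ring.
have /(_ l) := psumr_eq0P (fun m _ => exprn_ge0 2 (normr_ge0 (y m))) y0.
by rewrite li lj lk => /(_ isT)/eqP; rewrite sqrf_eq0 normr_eq0 => /eqP.
Qed.

Definition dependent_set (X : {set 'I_9}) :=
  exists i j k, [/\ X = [set i; j; k], uniq [:: i; j; k] & T i j k = 1].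

Lemma triple_rot i j k : T j k i = T i j k.
Proof. by rewrite /triple; ring. Qed.

Lemma triple_conj i j k : T i k j = (T i j k)^*.
Proof. by rewrite /triple !rmorphM /= !(pm_herm hP); ring. Qed.

Lemma card3_set (X : {set 'I_9}) i j k :
  #|X| = 3%N -> uniq [:: i; j; k] -> i \in X -> j \in X -> k \in X ->
  X = [set i; j; k].
Proof.
rewrite /= !inE negb_or => X3 /and3P[/andP[ij ik] jk _] iX jX kX.
apply/esym/eqP; rewrite eqEcard X3 -setUA cardsU1 cards2 !inE negb_or ij ik jk.
apply/andP; split=> //; apply/subsetP => m.
by rewrite !inE => /or3P[]/eqP->.
Qed.

Variable w : C.
Hypothesis w2 : w ^+ 2 + w + 1 = 0.

Lemma full_edge_third i j : i != j -> full_edge h i j ->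
  exists k, uniq [:: i; j; k] /\ T i j k = 1.
Proof.
move=> ij fij; case: (edge_dichotomy w2 hP ij) => [[_ _ [k [ki kj Tk]]]|[c3 _ _]].
  by exists k; rewrite /= !inE negb_or ij ![_ == k]eq_sym ki kj.
suff : #|[set k | T i j k ^+ 3 != 1]| = 0%N by rewrite c3.
by apply/eqP; rewrite cards_eq0 -subset0; apply/subsetP=> k; rewrite inE fij eqxx.
Qed.

Lemma dependent_full i j k : uniq [:: i; j; k] -> T i j k = 1 -> full_edge h i j.
Proof.
rewrite /= !inE negb_or => /and3P[/andP[ij ik] jk _] Tk.
case: (edge_dichotomy w2 hP ij) => [[]//|[_ _ /(_ k)]].
by rewrite Tk eqxx ![k == _]eq_sym ik jk => /(_ isT isT).
Qed.

(** A full edge inside X extends to a dependent triple, whose edges are all full; as no full edge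
    leaves X, the third index lies in X. *)
Lemma closed_dependent (X : {set 'I_9}) : #|X| = 3%N ->
  {in X &, forall i j, full_edge h i j} ->
  (forall i k, i \in X -> k \notin X -> ~ full_edge h i k) ->
  dependent_set X.
Proof.
move=> X3 fX nX; have /card_gt1P[i [j [iX jX ij]]] : (1 < #|X|)%N by rewrite X3.
have [k [u Tk]] := full_edge_third ij (fX _ _ iX jX).
exists i, j, k; split=> //; apply: card3_set => //.
apply: contraT => kX; case: (nX i k iX kX).
apply: (@dependent_full i k j); last by rewrite triple_conj Tk rmorph1.
by move: u; rewrite /= !inE !negb_or [k == j]eq_sym => /and3P[/andP[-> ->] -> _].
Qed.

Section Normalized.
Hypothesis h0 : forall k, h ord0 k = 1.

Let h0' k : h k ord0 = 1.
Proof. by rewrite -(pm_herm hP) h0 rmorph1. Qed.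

(** Two elements i, k of the level set extend to a dependent triple i, k, m. Its kernel relation at
    j and c times its relation at [ord0] differ only in the coefficient of h m i, which gives h j m
    = c. *)
Lemma level_set_dependent c j :
  c ^+ 2 + c + 1 = 0 -> (forall i k, i != k -> full_edge h i k) ->
  #|[set m | h j m == c]| = 3%N -> dependent_set [set m | h j m == c].
Proof.
move=> c2 full X3.
have c1 := cube_root_neq1 c2; have [cc1 cc2] := cube_root_twice c2.
have /card_gt1P[i [k [iX kX ik]]] : (1 < #|[set m | h j m == c]|)%N by rewrite X3.
have [m [u Tm]] := full_edge_third ik (full _ _ ik).
exists i, k, m; split=> //; apply: card3_set => //.
move: iX kX u Tm; rewrite !inE /= !inE negb_or andbT.
move=> /eqP hi /eqP hk /andP[/andP[_ im] km] Tm.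
have notX z n : h j z = c -> h j n = 1 -> n != z.
  by move=> hz hn; apply: contra_neq c1 => nz; rewrite -hz -nz hn.
have i0 := notX _ _ hi (h0' j); have k0 := notX _ _ hk (h0' j).
have ij := notX _ _ hi (pm_diag hP j); have kj := notX _ _ hk (pm_diag hP j).
have j0 : j != ord0.
  by apply: contra_neq c1 => jE; rewrite -hi jE h0.
have hki : h i k = 1 -> h k i = 1.
  by move=> E; rewrite -(pm_herm hP) E rmorph1.
(* A kernel relation needs a row outside the triple, so m = [ord0] and m = j are treated apart: both
   force h k i = 1, and the remaining relation becomes 2 c + 1 = 0 or 2 + c = 0. *)
have [m0|m0] := eqVneq m ord0.
  have ki1 : h k i = 1.
    by apply: hki; move: Tm; rewrite m0 /triple h0 h0' !mulr1.
  have := @dependent_kernel i k m j; rewrite /= !inE !negb_or ij kj im km ik m0 j0.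
  rewrite -m0 => /(_ isT Tm); rewrite hi hk ki1 m0 h0 h0'.
  by move/eqP; rewrite (_ : _ + _ = 2 * c + 1) ?(negPf cc1) //; ring.
have := @dependent_kernel i k m ord0; rewrite /= !inE !negb_or i0 k0 im km ik.
rewrite [ord0 == m]eq_sym m0 !h0 !mul1r => /(_ isT Tm) sum0.
have [mj|mj] := eqVneq m j.
  have ki1 : h k i = 1.
    by apply: hki; move: Tm; rewrite mj /triple hi -(pm_herm hP j) hk -mulrA mulrC
       -hk (pm_herm hP) hk -{1}hk (pm_inv hP) mul1r.
  move: sum0; rewrite ki1 mj hi => /eqP.
  by rewrite (_ : _ + _ = 2 + c) ?(negPf cc2) //; ring.
have := @dependent_kernel i k m j; rewrite /= !inE !negb_or ij kj im km ik.
rewrite [j == m]eq_sym mj hi hk => /(_ isT Tm) sumj.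
rewrite -(inj_eq (mulIf (_ : h m i != 0))); last first.
  by rewrite -normr_eq0 (pm_norm hP) oner_eq0.
rewrite -subr_eq0; apply/eqP.
transitivity ((c + c * h k i + h j m * h m i) - c * (1 + h k i + h m i)); first ring.
by rewrite sumj sum0 mulr0 subr0.
Qed.

Lemma cube_bipartite (f := fun i j => h i j ^+ 3) :
  (forall i j, f i j = 1) \/
  exists (A B : {set 'I_9}) (v : C),
    [/\ #|A| = 3%N, #|B| = 3%N, [disjoint A & B] & ord0 \notin A :|: B] /\
    v != 1 /\
    forall i j, f i j = if (i \in A) && (j \in B) then v
                        else if (i \in B) && (j \in A) then v^-1 else 1.
Proof.
have TE i j k : f i j * f j k * f k i = T i j k ^+ 3.
  by rewrite /f /triple !exprMn.
have LE i j : [set k | f i j * f j k * f k i != 1] = [set k | T i j k ^+ 3 != 1].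
  by apply/setP => k; rewrite !inE TE.
apply: bipartite_cocycle.
- by move=> i; rewrite /f (pm_diag hP) expr1n.
- by move=> i j; rewrite /f -exprMn (pm_inv hP) expr1n.
- by move=> k; rewrite /f h0 expr1n.
- move=> i j /(edge_dichotomy w2 hP)[[full _ _]|[c3 _ _]]; rewrite LE;
    [left|by right].
  by apply/eqP; rewrite cards_eq0 -subset0; apply/subsetP=> k; rewrite inE full eqxx.
move=> i j /(edge_dichotomy w2 hP)[[full _ _]|[_ c _]] k l; rewrite LE !inE !TE.
  by rewrite full eqxx.
exact: c.
Qed.

(** If all cubes are 1, the blocks are a dependent triple [ord0], j, k and the level sets of row j
    at w and w^2. Otherwise they are the two blocks of the cube pattern and their complement: edges
    are full inside a block and never between blocks. *)
Lemma dependent_partition :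
  exists D A B : {set 'I_9},
    [/\ [disjoint D & A], [disjoint D & B], [disjoint A & B] & ord0 \in D] /\
    [/\ dependent_set D, dependent_set A & dependent_set B].
Proof.
have TE i j k : T i j k ^+ 3 = h i j ^+ 3 * h j k ^+ 3 * h k i ^+ 3.
  by rewrite /triple !exprMn.
case: cube_bipartite => [f1|[A [B [v [[A3 B3 AB AB0] [v1 fE]]]]]].
  have full i k : full_edge h i k by move=> m; rewrite TE !f1 !mulr1.
  have [j [k [u Tjk]]] : exists j k, uniq [:: ord0; j; k] /\ T ord0 j k = 1.
    have o01 : ord0 != ord_max :> 'I_9 by [].
    by have [k] := full_edge_third o01 (full _ _); exists ord_max, k.
  have j0 : ord0 != j by move: u; rewrite /= !inE negb_or => /andP[/andP[]].
  have T0 m : T ord0 j m = h j m by rewrite /triple h0 h0' mul1r mulr1.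
  have hjk : h j k = 1 by rewrite -T0.
  have level c : c ^+ 2 + c + 1 = 0 ->
      [disjoint [set ord0; j; k] & [set m | h j m == c]] /\
      dependent_set [set m | h j m == c].
    move=> c2; have c1 := cube_root_neq1 c2; split.
      rewrite -setI_eq0 -subset0; apply/subsetP => m.
      rewrite !inE => /andP[mD /eqP hm]; case/eqP: c1; rewrite -hm.
      by case/orP: mD => [/orP[]|] /eqP->; rewrite ?h0' ?(pm_diag hP).
    apply: level_set_dependent => //.
    have [[_ /(_ c c2) E _]|[_ _ /(_ k)]] := edge_dichotomy w2 hP j0.
      by rewrite -[RHS]E; apply: eq_card => m; rewrite !inE T0.
    move: u; rewrite /= !inE negb_or Tjk eqxx ![k == _]eq_sym.
    by case/andP=> /andP[_ ->] /andP[-> _] /(_ isT isT).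
  have [dA A1] := level _ w2; have [dB B1] := level _ (sqr_cube_root_eq0 w2).
  exists [set ord0; j; k], [set m | h j m == w], [set m | h j m == w ^+ 2].
  split; split=> //; last by exists ord0, j, k.
    rewrite -setI_eq0 -subset0; apply/subsetP => m.
    rewrite !inE => /andP[/eqP-> ww].
    by move: (cube_root_sqr_neq w2); rewrite ww.
  by rewrite !inE eqxx.
move: AB0; rewrite in_setU negb_or => /andP[A0 B0].
pose D := ~: (A :|: B).
have DE m : (m \in D) = (m \notin A) && (m \notin B).
  by rewrite in_setC in_setU negb_or.
have BA m : m \in A -> m \notin B by move=> mA; rewrite (disjointFr AB mA).
have vV1 : v^-1 != 1 by rewrite invr_eq1.
have v0 : v != 0.
  apply/eqP => v0; have [a aA] : exists a, a \in A by apply/card_gt0P; rewrite A3.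
  have [b bB] : exists b, b \in B by apply/card_gt0P; rewrite B3.
  have := fE a b; rewrite aA bB v0 /= => /eqP; rewrite expf_eq0 /=.
  by rewrite -normr_eq0 (pm_norm hP) oner_eq0.
have [a aA] : exists a, a \in A by apply/card_gt0P; rewrite A3.
have [b bB] : exists b, b \in B by apply/card_gt0P; rewrite B3.
have aB := BA a aA; have bA : b \notin A by rewrite (disjointFl AB bB).
have D3 : #|D| = 3%N.
  have := cardsC (A :|: B); rewrite -/D card_ord cardsU disjoint_setI0 // cards0.
  by rewrite A3 B3 subn0 => /eqP; rewrite (@eqn_add2l 6 _ 3%N) => /eqP.
have cubeE i j m : T i j m ^+ 3 =
  (if (i \in A) && (j \in B) then v
   else if (i \in B) && (j \in A) then v^-1 else 1) *
  (if (j \in A) && (m \in B) then v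
   else if (j \in B) && (m \in A) then v^-1 else 1) *
  (if (m \in A) && (i \in B) then v
   else if (m \in B) && (i \in A) then v^-1 else 1).
  by rewrite TE -!fE.
(* For an edge between two blocks, the index that refutes fullness is always taken in the remaining
   block. *)
have notfull i j m : T i j m ^+ 3 \in [:: v; v^-1] -> ~ full_edge h i j.
  move=> Tm /(_ m) E; move: Tm.
  by rewrite E !inE ![1 == _]eq_sym (negPf v1) (negPf vV1).
exists D, A, B; split; last split.
- split=> //; rewrite ?DE ?A0 ?B0 // -setI_eq0 -subset0; apply/subsetP => m.
    by rewrite in_setI DE => /andP[/andP[/negPf->]].
  by rewrite in_setI DE => /andP[/andP[_ /negPf->]].
- apply: closed_dependent => // [i j|i k].
    rewrite !DE => /andP[/negPf iA /negPf iB] /andP[/negPf jA /negPf jB] m.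
    by rewrite cubeE iA iB jA jB !andbF !mulr1.
  rewrite !DE negb_and !negbK => /andP[/negPf iA /negPf iB] /orP[kA|kB].
    apply: (notfull _ _ b); rewrite cubeE iA iB kA bB (negPf (BA k kA)).
    by rewrite !andbF /= !mulr1 mul1r !inE eqxx.
  apply: (notfull _ _ a); rewrite cubeE iA iB kB aA.
  by rewrite !andbF /= (disjointFl AB kB) /= !mulr1 mul1r !inE eqxx orbT.
- apply: closed_dependent => // [i j iA jA m|i k iA kA].
    rewrite cubeE iA jA (negPf (BA i iA)) (negPf (BA j jA)) /= andbF mul1r.
    by case: (m \in B); rewrite /= ?andbF ?mulr1 ?divff.
  have iB := negPf (BA i iA).
  have [kB|kB] := boolP (k \in B).
    apply: (notfull _ _ ord0); rewrite cubeE iA kB (negPf A0) (negPf B0).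
    by rewrite !andbF /= !mulr1 !inE eqxx.
  apply: (notfull _ _ b); rewrite cubeE iA iB (negPf kA) (negPf kB) bB (negPf bA).
  by rewrite /= !mul1r !inE eqxx orbT.
apply: closed_dependent => // [i j iB jB m|i k iB kB].
  rewrite cubeE iB jB (disjointFl AB iB) (disjointFl AB jB) /= mul1r.
  by case: (m \in A); rewrite /= ?andbF ?mulr1 ?mulVf.
have iA := disjointFl AB iB.
have [kA|kA] := boolP (k \in A).
  apply: (notfull _ _ ord0); rewrite cubeE iA iB kA (negPf A0) (negPf B0).
  by rewrite !andbF /= !mulr1 !inE eqxx orbT.
apply: (notfull _ _ a); rewrite cubeE iA iB (negPf kA) (negPf kB) aA.
by rewrite /= !mul1r !inE eqxx.
Qed.
End Normalized.
End DependentTriples.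

(** * Reduction to the canonical matrix *)

Lemma uniq_map_nth (T : eqType) (x : T) s idx :
  perm_eq idx (iota 0 (size s)) -> uniq s -> uniq (map (nth x s) idx).
Proof.
move=> pidx us; rewrite (perm_uniq (perm_map _ pidx)).
by rewrite -/(mkseq _ _) mkseq_nth.
Qed.

Section Canonical.
Variables (C : numClosedFieldType) (w : C) (h : 'I_9 -> 'I_9 -> C).
Hypothesis w2 : w ^+ 2 + w + 1 = 0.
Hypothesis hP : phase_matrix h.
Local Notation T := (triple h).

Lemma sum_uniq9 (F : 'I_9 -> C) (s : seq 'I_9) :
  uniq s -> size s = 9%N -> \sum_k F k = \sum_(k <- s) F k.
Proof.
move=> us s9; apply: perm_big; apply: uniq_perm => //; first exact: index_enum_uniq.
have [] := uniq_min_size us (_ : {subset s <= index_enum 'I_9}) _ => //.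
- by move=> k _; rewrite mem_index_enum.
- by rewrite s9 -[index_enum _]enumT size_enum_ord.
by move=> _ sE k; rewrite sE.
Qed.

(** The solutions of the two equations form the line spanned by (1, w^2, w). *)
Lemma two_relations (p q r : C) :
  p + q + r = 0 -> p + w ^+ 2 * q + w * r = 0 -> q = p * w ^+ 2 /\ r = p * w.
Proof.
move=> e1 e2; have w1 : w - 1 != 0 by rewrite subr_eq0 (cube_root_neq1 w2).
have qE : q = p * w ^+ 2.
  apply: (mulfI w1); apply: (mulfI (cube_root_neq0 w2)).
  apply/eqP; rewrite -subr_eq0; apply/eqP.
  transitivity ((p + w ^+ 2 * q + w * r) - w * (p + q + r)
     + (w - 1) * p * (1 - w ^+ 3)); first by ring.
  by rewrite e1 e2 (cube_root1 w2) subrr !mulr0 subrr addr0.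
split=> //; apply/eqP; rewrite -subr_eq0 -e1 qE; apply/eqP.
transitivity (p + p * w ^+ 2 + r - p * (w ^+ 2 + w + 1));
  last by rewrite w2 mulr0 subr0.
by ring.
Qed.

Section Base.
Variables x0 x1 x2 : 'I_9.
Hypothesis h0 : forall k, h x0 k = 1.
Hypothesis T012 : T x0 x1 x2 = 1.

Let h0' k : h k x0 = 1.
Proof. by rewrite -(pm_herm hP) h0 rmorph1. Qed.

(** The kernel relation of the base triple reads 1 + h l x1 + h l x2 = 0; [unimodular_sum0] applies
    to its conjugate. *)
Lemma base_row l : uniq [:: x0; x1; x2; l] ->
  (h x1 l = w /\ h x2 l = w ^+ 2) \/ (h x1 l = w ^+ 2 /\ h x2 l = w).
Proof.
rewrite -(rot_uniq 3) => u; have := dependent_kernel hP u T012; rewrite !h0' !mulr1.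
move/(congr1 Num.conj); rewrite !rmorphD rmorph1 rmorph0 /= !(pm_herm hP).
by apply: unimodular_sum0; rewrite // (pm_herm hP) (pm_inv hP).
Qed.

(** The kernel relation at x0 fixes the entries inside the block. The one at x1 makes the three
    entries of row x1 have product 1; as each is w or w^2, they are equal. *)
Lemma block_row a b c :
  uniq [:: x0; x1; x2; a; b; c] -> T a b c = 1 ->
  [/\ h x1 b = h x1 a, h x1 c = h x1 a &
      (h b a = w /\ h c a = w ^+ 2) \/ (h b a = w ^+ 2 /\ h c a = w)].
Proof.
move=> u Tabc; have w3 := cube_root1 w2; have w1 := cube_root_neq1 w2.
have w21 := cube_root_sqr_neq1 w2.
have u0 := mask_uniq u [:: true; false; false; true; true; true].
have u1 := mask_uniq u [:: false; true; false; true; true; true].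
have ua := mask_uniq u [:: true; true; true; true; false; false].
have ub := mask_uniq u [:: true; true; true; false; true; false].
have uc := mask_uniq u [:: true; true; true; false; false; true].
have := dependent_kernel hP u0 Tabc; rewrite !h0 !mul1r => sum0.
have cases : (h b a = w /\ h c a = w ^+ 2) \/ (h b a = w ^+ 2 /\ h c a = w).
  by apply: unimodular_sum0 => //; rewrite (pm_herm hP) (pm_inv hP).
have sum1 := dependent_kernel hP u1 Tabc.
have w23 : (w ^+ 2) ^+ 3 = 1 by rewrite exprAC w3 expr1n.
have cube l : uniq [:: x0; x1; x2; l] -> h x1 l ^+ 3 = 1.
  by case/base_row => -[-> _].
have [ba3 ca3 bca] : [/\ h b a ^+ 3 = 1, h c a ^+ 3 = 1 & h b a * h c a = 1].
  by case: cases => -[-> ->]; rewrite w3 w23 ?[_ ^+ 2 * _]mulrC -exprS w3.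
(* Three cube roots of unity with zero sum have product 1, by the factorisation
   of p^3 + q^3 + r^3 - 3pqr. *)
have prod1 : h x1 a * h x1 b * h x1 c = 1.
  apply: (@mulfI _ 3); rewrite ?pnatr_eq0 //.
  set p := h x1 a in sum1 *; set q := h x1 b in sum1 *; set r := h x1 c in sum1 *.
  have -> : 3 * (p * q * r) = 3 * (p * q * r) * (h b a * h c a) by rewrite bca mulr1.
  have -> : 3 * (p * q * r) * (h b a * h c a) =
     p ^+ 3 + q ^+ 3 * h b a ^+ 3 + r ^+ 3 * h c a ^+ 3
     - (p + q * h b a + r * h c a) * (p ^+ 2 + (q * h b a) ^+ 2 + (r * h c a) ^+ 2
         - p * (q * h b a) - p * (r * h c a) - (q * h b a) * (r * h c a)) by ring.
  by rewrite sum1 mul0r /p /q /r !cube // ba3 ca3; ring.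
case: (base_row ua) (base_row ub) (base_row uc) prod1
  => -[-> _] [] [-> _] [] [-> _] E; split=> //; exfalso;
  first [ by case/eqP: w1; rewrite -E -[LHS]mulr1 -w3; ring
        | by case/eqP: w21; rewrite -E -[LHS]mulr1 -w3; ring ].
Qed.

Variables x3 x4 x5 x6 x7 x8 : 'I_9.
Let x := [:: x0; x1; x2; x3; x4; x5; x6; x7; x8].
Hypothesis ux : uniq x.
Hypothesis T345 : T x3 x4 x5 = 1.
Hypothesis T678 : T x6 x7 x8 = 1.

Lemma row_sum l : l != x0 ->
  h l x0 + h l x1 + h l x2 + (h l x3 + h l x4 + h l x5)
    + (h l x6 + h l x7 + h l x8) = 0.
Proof.
move/(pm_orth hP); under eq_bigr do rewrite h0' mulr1.
by rewrite (sum_uniq9 _ ux) // !big_cons big_nil => <-; ring.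
Qed.

Hypothesis h13 : h x1 x3 = w.
Hypothesis h16 : h x1 x6 = w ^+ 2.
Hypothesis h43 : h x4 x3 = w.
Hypothesis h76 : h x7 x6 = w ^+ 2.

(** The rows of [H9] over an arbitrary closed field, with [w] for [omega]. *)
Definition canonical_row (a : C) (i : nat) : seq C :=
  let b := a^* in
  nth [::] [::
    [:: 1; 1; 1; 1; 1; 1; 1; 1; 1];
    [:: 1; 1; 1; w; w; w; w ^+ 2; w ^+ 2; w ^+ 2];
    [:: 1; 1; 1; w ^+ 2; w ^+ 2; w ^+ 2; w; w; w];
    [:: 1; w ^+ 2; w; 1; w ^+ 2; w; a; a * w ^+ 2; a * w];
    [:: 1; w ^+ 2; w; w; 1; w ^+ 2; a * w ^+ 2; a * w; a];
    [:: 1; w ^+ 2; w; w ^+ 2; w; 1; a * w; a; a * w ^+ 2];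
    [:: 1; w; w ^+ 2; b; b * w; b * w ^+ 2; 1; w; w ^+ 2];
    [:: 1; w; w ^+ 2; b * w; b * w ^+ 2; b; w ^+ 2; 1; w];
    [:: 1; w; w ^+ 2; b * w ^+ 2; b; b * w; w; w ^+ 2; 1]] i.

(** Rows x1, x2 and the diagonal blocks come from [base_row] and [block_row]. In the block with rows
    x3, x4, x5 and columns x6, x7, x8, every row and the first column satisfy [two_relations], so h
    x3 x6 determines it; the rest follows by conjugation. *)
Lemma canonical_entries i j : (i < 9)%N -> (j < 9)%N ->
  h (nth x0 x i) (nth x0 x j) = nth 0 (canonical_row (h x3 x6) i) j.
Proof.
have w3 := cube_root1 w2; have cw := cube_root_conj w2.
have cww : (w ^+ 2)^* = w by rewrite -cw conjCK.
have w4 : w ^+ 2 * w ^+ 2 = w by rewrite -exprD (exprD w 3 1) w3 mul1r.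
have ww : w * w = w ^+ 2 by [].
have ww' : w ^+ 2 * w = 1 by rewrite -exprSr.
have wwC : w * w ^+ 2 = 1 by rewrite -exprS.
have h12 : h x1 x2 = 1 by move: T012; rewrite /triple h0 h0' mul1r mulr1.
have uA := mask_uniq ux [:: true; true; true; true; true; true].
have uB := mask_uniq ux [:: true; true; true; false; false; false; true; true; true].
have [h14 h15 hA] := block_row uA T345; have [h17 h18 hB] := block_row uB T678.
rewrite h13 in h14 h15; rewrite h16 in h17 h18.
have ww1 := cube_root_sqr_neq w2.
have h53 : h x5 x3 = w ^+ 2.
  by case: hA => -[] //; rewrite h43 => E; rewrite -E eqxx in ww1.
have h86 : h x8 x6 = w.
  by case: hB => -[] //; rewrite h76 => E; rewrite E eqxx in ww1.
have h34 : h x3 x4 = w ^+ 2 by rewrite -(pm_herm hP) h43.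
have h35 : h x3 x5 = w by rewrite -(pm_herm hP) h53.
have h67 : h x6 x7 = w by rewrite -(pm_herm hP) h76.
have h68 : h x6 x8 = w ^+ 2 by rewrite -(pm_herm hP) h86.
have w0 := cube_root_neq0 w2.
have h45 : h x4 x5 = w ^+ 2.
  apply: (mulfI w0); rewrite wwC -T345 /triple h34 h53.
  by rewrite mulrAC w4.
have h78 : h x7 x8 = w.
  apply: (mulfI (_ : w ^+ 2 != 0)); first by rewrite expf_neq0.
  by rewrite ww' -T678 /triple h67 h86; ring.
(* The entries h x1 l and h x2 l are w and w^2 in some order, and each of these is the square of the
   other. *)
have row2 l c : uniq [:: x0; x1; x2; l] -> h x1 l = c -> h x2 l = c * c.
  by move=> u <-; case: (base_row u) => -[-> ->]; rewrite ?w4.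
have un m := mask_uniq ux m.
have [h23 h24 h25] : [/\ h x2 x3 = w ^+ 2, h x2 x4 = w ^+ 2 & h x2 x5 = w ^+ 2].
  rewrite -ww; split; apply: row2 => //.
  - exact: (un [:: true; true; true; true]).
  - exact: (un [:: true; true; true; false; true]).
  - exact: (un [:: true; true; true; false; false; true]).
have [h26 h27 h28] : [/\ h x2 x6 = w, h x2 x7 = w & h x2 x8 = w].
  rewrite -w4; split; apply: row2; rewrite ?w4 //.
  - exact: (un (nseq 3 true ++ nseq 3 false ++ [:: true])).
  - exact: (un (nseq 3 true ++ nseq 4 false ++ [:: true])).
  - exact: (un (nseq 3 true ++ nseq 5 false ++ [:: true])).
have conj_h k l c c' : c^* = c' -> h k l = c -> h l k = c'.
  by move=> <- <-; rewrite (pm_herm hP).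
have [h31 h41 h51] : [/\ h x3 x1 = w ^+ 2, h x4 x1 = w ^+ 2 & h x5 x1 = w ^+ 2].
  by split; apply: (conj_h _ _ _ _ cw).
have [h61 h71 h81] : [/\ h x6 x1 = w, h x7 x1 = w & h x8 x1 = w].
  by split; apply: (conj_h _ _ _ _ cww).
have [h32 h42 h52] : [/\ h x3 x2 = w, h x4 x2 = w & h x5 x2 = w].
  by split; apply: (conj_h _ _ _ _ cww).
have [h62 h72 h82] : [/\ h x6 x2 = w ^+ 2, h x7 x2 = w ^+ 2 & h x8 x2 = w ^+ 2].
  by split; apply: (conj_h _ _ _ _ cw).
have h54 := conj_h _ _ _ _ cww h45; have h87 := conj_h _ _ _ _ cw h78.
have h21 : h x2 x1 = 1 by rewrite -(pm_herm hP) h12 rmorph1.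
have hd := pm_diag hP.
have neq0 l : uniq [:: x0; l] -> l != x0 by rewrite /= inE andbT eq_sym.
have sumw : 1 + w ^+ 2 + w = 0 by rewrite -w2; ring.
have sumw' : 1 + w + w ^+ 2 = 0 by rewrite -w2; ring.
(* The row sum supplies the first equation of [two_relations], the kernel relation of the third
   triple the second. *)
have row_rel l : l != x0 -> uniq [:: l; x6; x7; x8] ->
    h l x1 + h l x2 = - 1 -> h l x3 + h l x4 + h l x5 = 0 ->
    h l x7 = h l x6 * w ^+ 2 /\ h l x8 = h l x6 * w.
  move=> l0 u e12 e345; apply: two_relations.
    by have := row_sum l0; rewrite h0' -(addrA 1 (h l x1)) e12 e345 subrr !add0r.
  by have := dependent_kernel hP u T678; rewrite h76 h86 ![_ * h l _]mulrC.
have w12 : w ^+ 2 + w = -1 by rewrite -[LHS]subr0 -w2; ring.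
have w12' : w + w ^+ 2 = -1 by rewrite -w12 addrC.
have [h37 h38] : h x3 x7 = h x3 x6 * w ^+ 2 /\ h x3 x8 = h x3 x6 * w.
  apply: row_rel; rewrite ?hd ?h31 ?h32 ?h34 ?h35 //.
    by apply: neq0; exact: (un [:: true; false; false; true]).
  exact: (un (nseq 3 false ++ [:: true; false; false; true; true; true])).
have [h47 h48] : h x4 x7 = h x4 x6 * w ^+ 2 /\ h x4 x8 = h x4 x6 * w.
  apply: row_rel; rewrite ?hd ?h41 ?h42 ?h43 ?h45 // 1?[w + 1]addrC //.
    by apply: neq0; exact: (un [:: true; false; false; false; true]).
  exact: (un (nseq 4 false ++ [:: true; false; true; true; true])).
have [h57 h58] : h x5 x7 = h x5 x6 * w ^+ 2 /\ h x5 x8 = h x5 x6 * w.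
  apply: row_rel; rewrite ?hd ?h51 ?h52 ?h53 ?h54 //.
    by apply: neq0; exact: (un (true :: nseq 4 false ++ [:: true])).
  exact: (un (nseq 5 false ++ nseq 4 true)).
(* The same argument for row x6 and the second triple, conjugated so as to concern column x6. *)
have [h46 h56] : h x4 x6 = h x3 x6 * w ^+ 2 /\ h x5 x6 = h x3 x6 * w.
  have x60 : x6 != x0.
    by apply: neq0; exact: (un (true :: nseq 5 false ++ [:: true])).
  have u6 : uniq [:: x6; x3; x4; x5].
    by rewrite -(rot_uniq 1); exact: (un (nseq 3 false ++ nseq 4 true)).
  apply: two_relations.
    have := row_sum x60; rewrite h0' h61 h62 hd h67 h68 sumw' addr0 add0r.
    by move/(congr1 Num.conj); rewrite !rmorphD rmorph0 /= !(pm_herm hP).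
  have := dependent_kernel hP u6 T345; rewrite h43 h53 => /(congr1 Num.conj).
  rewrite !rmorphD !rmorphM rmorph0 /= !(pm_herm hP) => <-.
  by rewrite cw w4; ring.
have aw3 : h x3 x6 * w ^+ 2 * w ^+ 2 = h x3 x6 * w by rewrite -mulrA w4.
have aw2 : h x3 x6 * w * w ^+ 2 = h x3 x6 by rewrite -mulrA wwC mulr1.
have aw2' : h x3 x6 * w ^+ 2 * w = h x3 x6 by rewrite -mulrA ww' mulr1.
have aww : h x3 x6 * w * w = h x3 x6 * w ^+ 2 by rewrite -mulrA.
rewrite h46 aw3 in h47; rewrite h46 aw2' in h48.
rewrite h56 aw2 in h57; rewrite h56 aww in h58.
have conj_a k l : (h k l * w)^* = h l k * w ^+ 2 /\ (h k l * w ^+ 2)^* = h l k * w.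
  by rewrite !rmorphM /= (pm_herm hP) cw w4.
have [ca1 ca2] := conj_a x3 x6.
have h74 := conj_h _ _ _ _ erefl h47; have h84 := conj_h _ _ _ _ erefl h48.
have h75 := conj_h _ _ _ _ erefl h57; have h85 := conj_h _ _ _ _ erefl h58.
have h73 := conj_h _ _ _ _ erefl h37; have h83 := conj_h _ _ _ _ erefl h38.
have h64 := conj_h _ _ _ _ erefl h46; have h65 := conj_h _ _ _ _ erefl h56.
rewrite ?ca1 ?ca2 in h74 h84 h75 h85 h73 h83 h64 h65.
case: i => [|[|[|[|[|[|[|[|[|]]]]]]]]] //;
  case: j => [|[|[|[|[|[|[|[|[|]]]]]]]]] //=;
  by rewrite ?(pm_herm hP).
Qed.
End Base.

Definition canonical_list (s : seq 'I_9) :=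
  [/\ uniq s, size s = 9%N & exists a, `|a| = 1 /\
    forall i j, (i < 9)%N -> (j < 9)%N ->
      h (nth ord0 s i) (nth ord0 s j) = nth 0 (canonical_row a i) j].

Section Reorder.
Variables x0 x1 x2 : 'I_9.
Hypothesis h0 : forall k, h x0 k = 1.
Hypothesis T012 : T x0 x1 x2 = 1.

(** Exchanging the last two indices of a block keeps its triple product 1 and exchanges w with w^2
    in its first column, so each block can be given the orientation that [canonical_entries]
    requires. *)
Lemma canonical_list_of_blocks x3 x4 x5 x6 x7 x8
    (x := [:: x0; x1; x2; x3; x4; x5; x6; x7; x8]) :
  uniq x -> T x3 x4 x5 = 1 -> T x6 x7 x8 = 1 -> h x1 x3 = w -> h x1 x6 = w ^+ 2 ->
  exists s, canonical_list s.
Proof.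
move=> ux T345 T678 h13 h16.
have canon y4 y5 y7 y8 (y := [:: x0; x1; x2; x3; y4; y5; x6; y7; y8]) :
    uniq y -> T x3 y4 y5 = 1 -> T x6 y7 y8 = 1 -> h y4 x3 = w -> h y7 x6 = w ^+ 2 ->
    exists s, canonical_list s.
  move=> uy T3 T6 h43 h76; exists y; split=> //.
  exists (h x3 x6); split=> [|i j i9 j9]; first exact: pm_norm.
  rewrite !(set_nth_default x0) //.
  exact: (canonical_entries h0 T012 uy T3 T6 h13 h16 h43 h76).
have reorder idx p := @uniq_map_nth _ x0 x idx p ux.
have T354 : T x3 x5 x4 = 1 by rewrite (triple_conj hP) T345 rmorph1.
have T687 : T x6 x8 x7 = 1 by rewrite (triple_conj hP) T678 rmorph1.
have [_ _ hA] := block_row h0 T012 (mask_uniq ux (nseq 6 true)) T345.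
have [_ _ hB] := block_row h0 T012
  (mask_uniq ux (nseq 3 true ++ nseq 3 false ++ nseq 3 true)) T678.
case: hA hB => -[h43 h53] [] [h76 h86].
- exact: (canon _ _ _ _ (reorder [:: 0; 1; 2; 3; 4; 5; 6; 8; 7]%N isT)).
- exact: (canon _ _ _ _ (reorder [:: 0; 1; 2; 3; 4; 5; 6; 7; 8]%N isT)).
- exact: (canon _ _ _ _ (reorder [:: 0; 1; 2; 3; 5; 4; 6; 8; 7]%N isT)).
- exact: (canon _ _ _ _ (reorder [:: 0; 1; 2; 3; 5; 4; 6; 7; 8]%N isT)).
Qed.

(** If row x1 took the same value c on both blocks, its sum would be 3 (1 + 2 c), which is not 0. So
    the values are w and w^2, and exchanging the blocks if necessary puts w first. *)
Lemma canonical_list_of_triples x3 x4 x5 x6 x7 x8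
    (x := [:: x0; x1; x2; x3; x4; x5; x6; x7; x8]) :
  uniq x -> T x3 x4 x5 = 1 -> T x6 x7 x8 = 1 -> exists s, canonical_list s.
Proof.
move=> ux T345 T678.
have uA := mask_uniq ux (nseq 6 true).
have uB := mask_uniq ux (nseq 3 true ++ nseq 3 false ++ nseq 3 true).
have u3 := mask_uniq ux (nseq 4 true).
have u6 := mask_uniq ux (nseq 3 true ++ nseq 3 false ++ [:: true]).
have uBA : uniq [:: x0; x1; x2; x6; x7; x8; x3; x4; x5].
  exact: (@uniq_map_nth _ x0 x [:: 0; 1; 2; 6; 7; 8; 3; 4; 5]%N isT ux).
have h1_neq c : h x1 x3 = c -> h x1 x6 = c -> 2 * c + 1 != 0 -> False.
  move=> h13 h16 /eqP; apply.
  have [h14 h15 _] := block_row h0 T012 uA T345.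
  have [h17 h18 _] := block_row h0 T012 uB T678.
  have x10 : x1 != x0.
    by have := mask_uniq ux [:: true; true]; rewrite /= inE andbT eq_sym.
  have h12 : h x1 x2 = 1.
    move: T012; rewrite /triple h0 mul1r -(pm_herm hP x0 x2) h0 rmorph1.
    by rewrite mulr1.
  have := row_sum h0 ux x10; rewrite h14 h15 h17 h18 h13 h16 h12 (pm_diag hP).
  rewrite -(pm_herm hP) h0 rmorph1 => sum0.
  apply: (@mulfI _ 3); rewrite ?pnatr_eq0 // mulr0 -sum0; ring.
have [w21 _] := cube_root_twice w2.
have [ww21 _] := cube_root_twice (sqr_cube_root_eq0 w2).
case: (base_row h0 T012 u3) (base_row h0 T012 u6) => -[h13 _] [] [h16 _].
- by case: (h1_neq w).
- exact: (canonical_list_of_blocks ux).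
- exact: (canonical_list_of_blocks uBA).
- by case: (h1_neq (w ^+ 2)).
Qed.
End Reorder.

Lemma canonical_list_exists : (forall k, h ord0 k = 1) -> exists s, canonical_list s.
Proof.
move=> h0.
have [D [A [B [[DA DB AB D0] [dD dA dB]]]]] := dependent_partition hP w2 h0.
have memE (X : {set 'I_9}) a b c : X = [set a; b; c] -> X =i [:: a; b; c].
  by move=> -> m; rewrite !inE orbA.
have [j [k [inD uD T0]]] : exists j k,
    [/\ D =i [:: ord0; j; k], uniq [:: ord0; j; k] & T ord0 j k = 1].
  (* Triple products are invariant under rotation, which brings [ord0] to the front. *)
  case: dD => i [j [k [/memE Di uD Tijk]]]; move: D0; rewrite Di !inE.
  case/or3P => /eqP E.
  - by exists j, k; rewrite E.
  - exists k, i; rewrite E triple_rot; split=> //.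
      by move=> m; rewrite Di -(mem_rot 1).
    by rewrite -(rot_uniq 2).
  - exists i, j; rewrite E -triple_rot; split=> //.
      by move=> m; rewrite Di -(mem_rot 2).
    by rewrite -(rot_uniq 1).
case: dA => a [a' [a'' [/memE inA uA TA]]].
case: dB => b [b' [b'' [/memE inB uB TB]]].
apply: (canonical_list_of_triples h0 T0 (_ : uniq _) TA TB).
have -> : [:: ord0; j; k; a; a'; a''; b; b'; b''] =
  [:: ord0; j; k] ++ [:: a; a'; a''] ++ [:: b; b'; b''] by [].
have disj (X Y : {set 'I_9}) (s t : seq 'I_9) :
    [disjoint X & Y] -> X =i s -> Y =i t -> has (mem s) t = false.
  move=> XY Xs Yt; apply/hasPn => m /=.
  by rewrite -Xs -Yt => mY; rewrite (disjointFl XY mY).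
rewrite !cat_uniq uD uA uB has_cat.
rewrite (disj _ _ _ _ DA inD inA) (disj _ _ _ _ DB inD inB).
by rewrite (disj _ _ _ _ AB inA inB).
Qed.
End Canonical.

(** * From the frame to its phase matrix and back *)

Section Frame.
Variables (C : numClosedFieldType) (phi : 'I_9 -> 'cV[C]_3).
Hypothesis etf : is_etf phi.
Local Notation G := (gram phi).

Definition signature_phase i j : C := (3 *: 1%:M - 2 *: G) i j.

(** The indices are swapped because [dotmx] conjugates its second argument and [gram] its first
    factor. *)
Lemma cdot_gram i j : cdot (phi i) (phi j) = G j i.
Proof.
by rewrite /cdot dotmxE !mxE; apply: eq_bigr => k _; rewrite !mxE mulrC.
Qed.

Lemma gram_conj i j : (G i j)^* = G j i.
Proof.
rewrite !mxE rmorph_sum; apply: eq_bigr => k _.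
by rewrite !mxE rmorphM /= conjCK mulrC.
Qed.

Lemma gram_diag i : G i i = 1.
Proof.
case: etf => _ /(_ i) + _ _; rewrite /cnorm cdot_gram => /(congr1 (fun x => x ^+ 2)).
by rewrite sqrtCK expr1n.
Qed.

Lemma etf_angle93 : etf_angle C 9%N 3%N = 1 / 2.
Proof.
rewrite /etf_angle.
have -> : (9%:R - 3%:R) / (3%:R * (9%:R - 1)) = (1 / 2) ^+ 2 :> C.
  by field.
by rewrite sqrCK // divr_ge0.
Qed.

Lemma gram_norm i j : i != j -> G i j * G j i = 1 / 4.
Proof.
case: etf => _ _ angle _ ij.
have lt_norm (a b : 'I_9) : (a < b)%N -> G a b * G b a = 1 / 4.
  move=> /angle; rewrite cdot_gram etf_angle93 => E.
  by rewrite -(gram_conj b a) mulrC -normCK E; field.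
have [/lt_norm//|] := ltnP i j; rewrite leq_eqVlt => /orP[/eqP/val_inj E|/lt_norm].
  by rewrite E eqxx in ij.
by rewrite mulrC.
Qed.

Lemma gram_sqr : G *m G = 3 *: G.
Proof.
case: etf => _ _ _ tight; rewrite /gram -mulmxA (mulmxA (frame_mx phi)) tight.
by rewrite mul_scalar_mx -scalemxAr; congr (_ *: _); field.
Qed.

(** Orthogonality is H^2 = 9 I - 12 G + 4 G^2 = 9 I, by tightness; unimodularity off the diagonal is
    |G i j| = 1/2. *)
Lemma signature_phase_matrix : phase_matrix signature_phase.
Proof.
have hE i j : signature_phase i j = 3 * (i == j)%:R - 2 * G i j.
  by rewrite /signature_phase !mxE.
split=> [i|i j|i j|i j ij].
- by rewrite hE eqxx gram_diag /=; ring.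
- by rewrite !hE eq_sym rmorphB !rmorphM /= gram_conj !rmorph_nat.
- rewrite !hE (eq_sym j i); case: eqVneq => [->|ij].
    by rewrite gram_diag /=; ring.
  have -> : (3 * false%:R - 2 * G i j) * (3 * false%:R - 2 * G j i) =
      4 * (G i j * G j i).
    by rewrite /=; ring.
  by rewrite gram_norm //; field.
pose H : 'M[C]_9 := 3 *: 1%:M - 2 *: G.
have HH : H *m H = 9%:M.
  rewrite /H mulmxBl !mulmxBr -!scalemxAl -!scalemxAr !mul1mx !mulmx1 gram_sqr.
  rewrite -[9%:M]scalemx1; move: G => X; apply/matrixP => k l.
  by rewrite !mxE; ring.
by have := congr1 (fun M : 'M_9 => M i j) HH; rewrite !mxE (negPf ij).
Qed.
End Frame.

(** Conjugation by a unitary diagonal matrix, used to turn the first row into ones. *)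
Lemma rescale_phase_matrix (C : numClosedFieldType)
    (h : 'I_9 -> 'I_9 -> C) (d : 'I_9 -> C) :
  phase_matrix h -> (forall i, d i * (d i)^* = 1) ->
  phase_matrix (fun i j => d i * h i j * (d j)^*).
Proof.
move=> hP d1; have d1' i : (d i)^* * d i = 1 by rewrite mulrC.
split=> [i|i j|i j|i j ij].
- by rewrite (pm_diag hP) mulr1.
- by rewrite !rmorphM /= conjCK (pm_herm hP); ring.
- have -> : d i * h i j * (d j)^* * (d j * h j i * (d i)^*) =
    (h i j * h j i) * (d i * (d i)^*) * (d j * (d j)^*) by ring.
  by rewrite (pm_inv hP) !d1 !mulr1.
transitivity (d i * (d j)^* * \sum_k h i k * h k j);
  last by rewrite (pm_orth hP) ?mulr0.
rewrite mulr_sumr; apply: eq_bigr => k _.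
have -> : d i * h i k * (d k)^* * (d k * h k j * (d j)^*) =
    d i * (d j)^* * (h i k * h k j) * (d k * (d k)^*) by ring.
by rewrite d1 mulr1.
Qed.

Lemma omega_root (R : realType) : omega R ^+ 2 + omega R + 1 = 0.
Proof.
apply/eqP; rewrite eq_complex /omega /=.
have s3 : Num.sqrt 3 ^+ 2 = 3 :> R by rewrite sqr_sqrtr // ler0n.
set s : R := Num.sqrt 3 in s3 *.
apply/andP; split; apply/eqP.
  transitivity (1 - 1 / 4 - s ^+ 2 / 4 : R); first by field.
  by rewrite s3; field.
by field.
Qed.

Theorem corollary4p7 (R : realType) (phi : 'I_9 -> 'cV[R[i]]_3) :
  is_etf phi ->
  exists a : R[i], `|a| = 1 /\ gram_equiv (gram phi) (G9 a).
Proof.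
move=> etf; pose h := signature_phase phi.
have hP : phase_matrix h := signature_phase_matrix etf.
(* Rescaling by the first row itself normalises it: the new entry is h 0 k times its own
   conjugate. *)
pose d k := h ord0 k.
have d1 k : d k * (d k)^* = 1 by rewrite /d (pm_herm hP) (pm_inv hP).
have nP := rescale_phase_matrix hP d1.
have n0 k : d ord0 * h ord0 k * (d k)^* = 1.
  by rewrite {1}/d (pm_diag hP) mul1r d1.
have [s [us s9 [a [a1 sE]]]] := canonical_list_exists (omega_root R) nP n0.
exists a; split=> //.
have inj_s : injective (fun i : 'I_9 => nth ord0 s i).
  move=> i j /eqP; rewrite nth_uniq ?s9 //.
  by move/eqP/val_inj.
(* The permutation is the enumeration [s], as conjugation by [perm_mx] moves the entry at (s i, s j)
   to (i, j). *)
exists (perm inj_s), (\row_k d k); split.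
  apply/unitarymxP/matrixP => i j; rewrite mul_diag_mx !mxE.
  rewrite eq_sym; case: eqVneq => [->|_]; rewrite ?mulr1n ?d1 //.
  by rewrite mulr0n conjC0 mulr0.
have DGD k l : (diag_mx (\row_k d k) *m gram phi *m (diag_mx (\row_k d k)) ^t*) k l =
    d k * gram phi k l * (d l)^*.
  rewrite tr_diag_mx map_diag_mx mul_mx_diag mul_diag_mx !mxE.
  by [].
have -> (P D G E Q : 'M[R[i]]_9) : P *m D *m G *m E *m Q = P *m (D *m G *m E) *m Q.
  by rewrite !mulmxA.
rewrite tr_perm_mx -row_permE -col_permE.
apply/matrixP => i j; rewrite 2![RHS]mxE DGD !permE.
have HE : H9 a i j = nth 0 (canonical_row (omega R) a i) j by rewrite mxE.
have := sE i j (ltn_ord i) (ltn_ord j); rewrite -HE => {}HE.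
have -> : G9 a i j = 1 / 2 * (3 * (i == j)%:R - H9 a i j).
  by rewrite /G9; move: (H9 a) => M; rewrite !mxE.
rewrite -HE.
have gramE k l : gram phi k l = 1 / 2 * (3 * (k == l)%:R - h k l).
  by rewrite /h /signature_phase !mxE; field.
rewrite gramE -(inj_eq inj_s); case: eqVneq => [->|_]; last by rewrite /=; ring.
by rewrite (pm_diag hP) [RHS]mulrAC d1 [d _ * 1]mulr1 d1 !mul1r.
Qed.
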